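(* Let $\Omega\subset\mathbb R^d$, $d\le3$, be a bounded Lipschitz domain with boundary $\partial\Omega=\partial\Omega_1\cup\partial\Omega_2\cup\partial\Omega_3$, let $\delta>0$, let $\epsilon\in L^\infty(\Omega)$ satisfy $0<\epsilon_0\le\epsilon(x)\le\epsilon_1<\infty$ for a.e. $x\in\Omega$, and let the fixed Dirichlet data $f_1$ on $\partial\Omega_2$, $f_2$ on $\partial\Omega_3$ admit a lifting $g\in H^1(\Omega)$ ($g|_{\partial\Omega_2}=f_1$, $g|_{\partial\Omega_3}=f_2$). Let $X=L^2(\Omega)$ and $Y=\mathbb R^{N_{\mathrm{meas}}}$. Let $\mathcal W:X\to H^1(\Omega)$, $c\mapsto u$, be the solution operator assigning to $c$ the weak solution $u$ of $$-\nabla\cdot(\epsilon\nabla u)+2\delta^2\sinh(u)=c\ \text{ in }\Omega,\qquad \nabla u\cdot\boldsymbol n=0\ \text{ on }\partial\Omega_1,\qquad u=f_1\ \text{ on }\partial\Omega_2,\qquad u=f_2\ \text{ on }\partial\Omega_3,$$ and suppose that it satisfies, for some constant $\eta$, $\|\mathcal W(c_1)-\mathcal W(c_2)\|_{H^1(\Omega)}\le\eta\|c_1-c_2\|_{L^2(\Omega)}$ for all $c_1,c_2\in L^2(\Omega)$. Let the observation operator $\mathcal O:H^1(\Omega)\to Y$ be bounded and linear, let $\mathcal G=\mathcal O\circ\mathcal W$, let $\mu_0$ be a prior probability measure on $X$, let $\Sigma_\varepsilon$ be a positive definite noise covariance matrix, and set $J(c;y)=\frac12\|\Sigma_\varepsilon^{-1/2}(y-\mathcal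 G(c))\|_2^2$. Then: 1. The forward operator $\mathcal G:L^2(\Omega)\to\mathbb R^{N_{\mathrm{meas}}}$ is Lipschitz continuous, and the Bayesian inverse problem of inferring $c\sim\mu_0$ from $y=\mathcal G(c)+\varepsilon$, $\varepsilon\sim\mathcal N(0,\Sigma_\varepsilon)$, admits, for every $y\in Y$, a well-defined posterior probability measure $\mu^y$ given by $$\frac{d\mu^y}{d\mu_0}(c)=\frac{1}{z(y)}\exp(-J(c;y)),\qquad z(y)=\int_X\exp(-J(c;y))\,d\mu_0(c),$$ which is absolutely continuous with respect to $\mu_0$, i.e. $\mu^y\ll\mu_0$. 2. The posterior is stable with respect to the data in the Hellinger metric: for every $r>0$ there exists $C(r)>0$ such that for all $y_1,y_2\in Y$ with $\max\{\|y_1\|_Y,\|y_2\|_Y\}<r$, $$d_H(\mu^{y_1},\mu^{y_2})\le C(r)\,\|y_1-y_2\|_Y.$$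
   Context: Let $V_0=\{v\in H^1(\Omega): v=0\text{ on }\partial\Omega_2\cup\partial\Omega_3\}$ (in the sense of traces). A weak solution for given $c\in L^2(\Omega)$ is $u\in H^1(\Omega)$ with $u-g\in V_0$ and $\int_\Omega\epsilon\nabla u\cdot\nabla v\,dx+2\delta^2\int_\Omega\sinh(u)v\,dx=\int_\Omega cv\,dx$ for all $v\in V_0$ (all integrals being well defined); for every $c\in L^2(\Omega)$ there is a unique weak solution, so $\mathcal W$ is well defined. $X=L^2(\Omega)$ carries its Borel $\sigma$-algebra and $Y=\mathbb R^{N_{\mathrm{meas}}}$ the Euclidean norm. The Hellinger distance is $$d_H(\mu^{y_1},\mu^{y_2})^2=\frac12\int_X\left(\sqrt{\frac{d\mu^{y_1}}{d\mu_0}}-\sqrt{\frac{d\mu^{y_2}}{d\mu_0}}\right)^2d\mu_0.$$ *)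

(* Defs.v *)
From HB Require Import structures.
From mathcomp Require Import all_boot all_order all_algebra.
From mathcomp Require Import all_classical all_reals all_analysis.
From mathcomp Require Import measurable_realfun.
Set Implicit Arguments.
Unset Strict Implicit.
Unset Printing Implicit Defensive.
Import Order.TTheory GRing.Theory Num.Theory.
Import numFieldNormedType.Exports.
Local Open Scope classical_set_scope.
Local Open Scope ring_scope.

Section Euclidean.
Context {R : realType} {n : nat}.
Implicit Types (x y : 'cV[R]_n).

(* The library norm on matrices is the sup norm. *)
Definition dotv x y : R := \sum_i x i 0 * y i 0.
Definition enorm x : R := Num.sqrt (\sum_i x i 0 ^+ 2).

Definition posdefmx (S : 'M[R]_n) : Prop :=
  S^T = S /\ forall x, x != 0 -> 0 < dotv x (S *m x).

(* [S] is the symmetric positive definite matrix Sigma^{-1/2}. *)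
Definition inv_sqrtmx (Sigma S : 'M[R]_n) : Prop :=
  posdefmx S /\ S *m S = invmx Sigma.

End Euclidean.

Section CoverOuterMeasure.
Local Open Scope ereal_scope.
Context {R : realType} {T : Type}.

Definition cover_outer (rho : set T -> \bar R) (A : set T) : \bar R :=
  ereal_inf [set \sum_(k <oo) rho (F k) |
    F in [set F : (set T)^nat | A `<=` \bigcup_k F k]].

Definition outer_axioms (m : set T -> \bar R) : Prop :=
  [/\ m set0 = 0, forall A, 0 <= m A,
      {homo m : A B / A `<=` B >-> A <= B} & sigma_subadditive m].

Lemma outer_axioms_restr (m : set T -> \bar R) (D : set T) :
  outer_axioms m -> outer_axioms (fun A => m (A `&` D)).
Proof.
move=> [m0 mge0 mle msub]; split => //; first by rewrite set0I.
- by move=> A B AB; apply: mle; exact: setSI.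
- by move=> F; rewrite setI_bigcupl; exact: msub.
Qed.

Lemma outer_axioms_sup (I : Type) (P : set I) (i0 : I)
    (m : I -> set T -> \bar R) : P i0 ->
  (forall i, outer_axioms (m i)) ->
  outer_axioms (fun A => ereal_sup [set m i A | i in P]).
Proof.
move=> Pi0 mo; split.
- apply/eqP; rewrite eq_le; apply/andP; split.
    by apply: ge_ereal_sup => _ [i Pi <-]; case: (mo i) => ->.
  by apply: ereal_sup_ubound; exists i0 => //; case: (mo i0).
- move=> A; apply: (@le_trans _ _ (m i0 A)); first by case: (mo i0).
  by apply: ereal_sup_ubound; exists i0.
- move=> A B AB; apply: ge_ereal_sup => _ [i Pi <-].
  apply: (@le_trans _ _ (m i B)); first by case: (mo i) => _ _ h _; exact: h.
  by apply: ereal_sup_ubound; exists i.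
- move=> F; apply: ge_ereal_sup => _ [i Pi <-].
  have [_ h0 _ hs] := mo i.
  apply: (le_trans (hs F)); apply: lee_nneseries => // k _.
  by apply: ereal_sup_ubound; exists i.
Qed.

End CoverOuterMeasure.

Section CoverOuterMeasureAxioms.
Local Open Scope ereal_scope.
Context {R : realType} {T : pointedType}.

Lemma outer_axioms_cover (rho : set T -> \bar R) :
  rho set0 = 0 -> (forall A, 0 <= rho A) -> outer_axioms (cover_outer rho).
Proof.
move=> rho0 rhoge0.
have -> : cover_outer rho =
    @mu_ext _ (g_sigma_algebraType [set: set T]) R rho.
  apply/funext => A; rewrite /cover_outer /mu_ext; congr ereal_inf.
  apply/seteqP; split => x [F]; last by move=> [_ AF] <-; exists F.
  by move=> AF <-; exists F => //; split => // k; exact: sub_sigma_algebra.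
split.
- exact: (@mu_ext0 _ (g_sigma_algebraType [set: set T])).
- exact: (@mu_ext_ge0 _ (g_sigma_algebraType [set: set T])).
- exact: (@le_mu_ext _ (g_sigma_algebraType [set: set T])).
- exact: (@mu_ext_sigma_subadditive _ (g_sigma_algebraType [set: set T])).
Qed.

Definition cara_measure (mu : {outer_measure set T -> \bar R}) :
    {measure set (caratheodory_type mu) -> \bar R} :=
  [the measure _ _ of (mu : set (caratheodory_type mu) -> \bar R)].

End CoverOuterMeasureAxioms.

(* Lebesgue measure on a set [Omega] of R^n: the outer measure                *)
(* A |-> lambda^*(A `&` Omega) restricted to its Caratheodory sigma-algebra.  *)
Section Lebesgue.
Local Open Scope ereal_scope.
Context {R : realType} {n : nat}.

Definition box (a b : 'cV[R]_n) : set 'cV[R]_n :=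
  [set x | forall i, (a i 0 <= x i 0 <= b i 0)%R].

(* The empty set is singled out because of the dimension n = 0. *)
Definition box_volume (A : set 'cV[R]_n) : \bar R :=
  if A == set0 then 0 else
  ereal_inf [set (\prod_i (ab.2 i 0 - ab.1 i 0)%R)%:E |
    ab in [set ab : 'cV[R]_n * 'cV[R]_n |
            (forall i, ab.1 i 0 <= ab.2 i 0)%R /\ A `<=` box ab.1 ab.2]].

Definition lebesgue_outer (Omega : set 'cV[R]_n) (A : set 'cV[R]_n) : \bar R :=
  cover_outer box_volume (A `&` Omega).

Lemma lebesgue_outer_axioms Omega : outer_axioms (lebesgue_outer Omega).
Proof.
apply: (@outer_axioms_restr _ _ (cover_outer box_volume)).
apply: outer_axioms_cover; first by rewrite /box_volume eqxx.
move=> A; rewrite /box_volume; case: ifP => // _.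
apply: le_ereal_inf_tmp => _ [[a b] /= [ab _] <-].
by rewrite lee_fin; apply: prodr_ge0 => i _; rewrite subr_ge0.
Qed.

HB.instance Definition _ (Omega : set 'cV[R]_n) :=
  isOuterMeasure.Build R 'cV[R]_n (lebesgue_outer Omega)
    (let: And4 h _ _ _ := lebesgue_outer_axioms Omega in h)
    (let: And4 _ h _ _ := lebesgue_outer_axioms Omega in h)
    (let: And4 _ _ h _ := lebesgue_outer_axioms Omega in h)
    (let: And4 _ _ _ h := lebesgue_outer_axioms Omega in h).

Definition leb (Omega : set 'cV[R]_n) := cara_measure (lebesgue_outer Omega).

End Lebesgue.

Notation dom Omega := (caratheodory_type (lebesgue_outer Omega)).

(* s-dimensional Hausdorff measure on a set [Gamma], Euclidean metric, without *)
(* the normalizing constant, which is irrelevant for traces.                   *)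
Section Hausdorff.
Local Open Scope ereal_scope.
Context {R : realType} {n : nat}.

Definition diam (A : set 'cV[R]_n) : \bar R :=
  ereal_sup [set (enorm (xy.1 - xy.2))%:E | xy in A `*` A].

(* Since 0 ^+ 0 = 1, s = 0 gives the counting measure. *)
Definition diam_content (s : nat) (delta : R) (A : set 'cV[R]_n) : \bar R :=
  if A == set0 then 0 else
  if diam A <= delta%:E then (fine (diam A) ^+ s)%:E else +oo.

Definition hausdorff_outer (s : nat) (Gamma A : set 'cV[R]_n) : \bar R :=
  ereal_sup [set cover_outer (diam_content s delta) (A `&` Gamma) |
    delta in [set delta : R | (0 < delta)%R]].

Lemma hausdorff_outer_axioms s Gamma : outer_axioms (hausdorff_outer s Gamma).
Proof.
apply: (@outer_axioms_sup _ _ _ _ 1%R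
  (fun delta A => cover_outer (diam_content s delta) (A `&` Gamma))) => [|delta].
  exact: ltr01.
apply: (@outer_axioms_restr _ _ (cover_outer (diam_content s delta))).
apply: outer_axioms_cover; first by rewrite /diam_content eqxx.
move=> A; rewrite /diam_content; case: ifPn => // /set0P[x Ax].
case: ifP => // _; rewrite lee_fin; apply/exprn_ge0/fine_ge0.
apply: (@le_trans _ _ (enorm (x - x))%:E); first by rewrite lee_fin sqrtr_ge0.
by apply: ereal_sup_ubound; exists (x, x).
Qed.

HB.instance Definition _ (s : nat) (Gamma : set 'cV[R]_n) :=
  isOuterMeasure.Build R 'cV[R]_n (hausdorff_outer s Gamma)
    (let: And4 h _ _ _ := hausdorff_outer_axioms s Gamma in h)
    (let: And4 _ h _ _ := hausdorff_outer_axioms s Gamma in h)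
    (let: And4 _ _ h _ := hausdorff_outer_axioms s Gamma in h)
    (let: And4 _ _ _ h := hausdorff_outer_axioms s Gamma in h).

Definition boundary (Omega : set 'cV[R]_n) : set 'cV[R]_n :=
  closure Omega `&` closure (~` Omega).

Definition surf (Omega : set 'cV[R]_n) :=
  cara_measure (hausdorff_outer n.-1 (boundary Omega)).

End Hausdorff.

Notation surf_dom Omega :=
  (caratheodory_type (hausdorff_outer _ (boundary Omega))).

Section Domains.
Context {R : realType} {n : nat}.

(* Near each boundary point, Omega is the part of a ball lying strictly above *)
(* a Lipschitz graph in some unit direction e; only the values of gamma on    *)
(* the hyperplane orthogonal to e are used.                                   *)
Definition lipschitz_domain (Omega : set 'cV[R]_n) : Prop :=
  [/\ Omega !=set0, open Omega, connected Omega, bounded_set Omega &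
   forall x, boundary Omega x ->
   exists (r : R) (e : 'cV[R]_n) (gamma : 'cV[R]_n -> R),
   [/\ 0 < r, enorm e = 1,
       exists L : R, forall a b, `|gamma a - gamma b| <= L * enorm (a - b) &
       forall z, enorm (z - x) < r ->
         (Omega z <-> gamma (z - dotv z e *: e) < dotv z e)]].

Definition pderiv (i : 'I_n) (f : 'cV[R]_n -> R) (x : 'cV[R]_n) : R :=
  'D_(delta_mx i 0 : 'cV[R]_n) f x.

Fixpoint Ck (k : nat) (f : 'cV[R]_n -> R) : Prop :=
  continuous f /\
  if k is k'.+1 then forall i,
    (forall x, derivable f x (delta_mx i 0 : 'cV[R]_n)) /\ Ck k' (pderiv i f)
  else True.

Definition smooth (f : 'cV[R]_n -> R) : Prop := forall k, Ck k f.

Definition test_function (Omega : set 'cV[R]_n) (phi : 'cV[R]_n -> R) : Prop :=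
  smooth phi /\
  exists K, [/\ compact K, K `<=` Omega & forall x, ~ K x -> phi x = 0].

End Domains.

Section L2space.
Context {R : realType} {n : nat}.
Variable Omega : set 'cV[R]_n.

Definition L2 : Type := LspaceType (leb Omega) (lee1n 2).

Definition L2_fun (u : L2) : dom Omega -> R := (u : LspaceType _ _).
Coercion L2_fun : L2 >-> Funclass.

Definition L2norm (f : dom Omega -> R) : R :=
  fine ('N[leb Omega]_2%:E[EFin \o f])%E.

Definition L2dist (u v : L2) : R := L2norm (fun x => u x - v x).

Definition L2_open : set (set L2) :=
  [set U | forall u, U u ->
    exists2 r : R, 0 < r & forall v, L2dist u v < r -> U v].

Let zero : {mfun_ (leb Omega), (dom Omega) >-> (measurableTypeR R)} :=
  (\pi_({mfun_ (leb Omega), (dom Omega) >-> (measurableTypeR R)})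
    (cst 0 : {mfun (dom Omega) >-> (measurableTypeR R)}))%qT.

Let zero_finite : finite_norm (leb Omega) 2%:E zero.
Proof.
have /eqmodP/asboolP z0 : (repr zero =
    (cst 0 : {mfun (dom Omega) >-> (measurableTypeR R)})
    %[mod {mfun_ (leb Omega), (dom Omega) >-> (measurableTypeR R)}])%qT.
  by rewrite reprK.
rewrite /finite_norm unlock.
rewrite (_ : (\int[_]_x _)%E = 0%E) ?poweR_EFin ?ltry //.
rewrite (@ae_eq_integral _ _ _ _ _ (cst 0%E)).
- exact: integral0.
- exact: measurableT.
- rewrite (_ : (fun x => _) =
      EFin \o (fun x => `|(repr zero : {mfun _ >-> _}) x| `^ 2)); last first.
    by apply/funext.
  apply/measurable_EFinP.
  apply: (@measurableT_comp _ _ _ _ _ _ (@powR R ^~ 2)).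
    exact: measurable_powR.
  apply: measurableT_comp; first exact: normr_measurable.
  exact: measurable_funPT.
- exact: measurable_cst.
- apply: filterS z0 => x /= /(_ I) x0 _.
  by rewrite /aqEqMfun_to_fun x0 normr0 powR0.
Qed.

HB.instance Definition _ := @isFinLebesgue.Build _ _ _ (leb Omega) 2%:E
  (lee1n 2) zero zero_finite.

HB.instance Definition _ := gen_eqMixin L2.
HB.instance Definition _ := gen_choiceMixin L2.
HB.instance Definition _ := isPointed.Build L2 (zero : LspaceType _ _).

End L2space.

Arguments L2 {R n} Omega.

Section Sobolev.
Context {R : realType} {n : nat}.
Variable Omega : set 'cV[R]_n.

Record H1 : Type := MkH1 {
  H1_val :> L2 Omega;
  grad : 'I_n -> L2 Omega;
  grad_weak : forall i phi, test_function Omega phi ->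
    \int[leb Omega]_x (H1_val x * pderiv i phi x) =
      - \int[leb Omega]_x (grad i x * phi x) }.

Definition H1norm (u : H1) : R :=
  Num.sqrt (L2norm u ^+ 2 + \sum_i L2norm (grad u i) ^+ 2).

Definition H1dist (u v : H1) : R :=
  Num.sqrt (L2dist u v ^+ 2 + \sum_i L2dist (grad u i) (grad v i) ^+ 2).

(* w = a u + v in H^1; equality a.e. of the functions determines the class of *)
(* w and its weak gradient.                                                   *)
Definition H1_lin (a : R) (u v w : H1) : Prop :=
  {ae leb Omega, forall x, w x = a * u x + v x}.

Definition bounded_linear_H1 (N : nat) (O : H1 -> 'cV[R]_N) : Prop :=
  (forall a u v w, H1_lin a u v w -> O w = a *: O u + O v) /\
  exists M : R, forall u, enorm (O u) <= M * H1norm u.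

(* phi is the trace of u on the boundary: L^2-limit of the boundary values of *)
(* smooth functions on the closure of Omega converging to u in H^1.           *)
Definition is_trace (u : H1) (phi : 'cV[R]_n -> R) : Prop :=
  measurable_fun
    [set: caratheodory_type (hausdorff_outer n.-1 (boundary Omega))] phi /\
  exists v : nat -> 'cV[R]_n -> R,
  [/\ forall k, smooth (v k),
      (fun k => \int[leb Omega]_x ((v k x - u x) ^+ 2)%:E)%E @ \oo --> 0%E,
      forall i, (fun k =>
        \int[leb Omega]_x ((pderiv i (v k) x - grad u i x) ^+ 2)%:E)%E
        @ \oo --> 0%E &
      (fun k => \int[surf Omega]_x ((v k x - phi x) ^+ 2)%:E)%E
        @ \oo --> 0%E].

Definition trace_eq (u : H1) (Gamma : set 'cV[R]_n) (f : 'cV[R]_n -> R) : Prop :=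
  exists2 phi, is_trace u phi &
    {ae surf Omega, forall x, Gamma x -> phi x = f x}.

Definition V0 (Gamma2 Gamma3 : set 'cV[R]_n) (v : H1) : Prop :=
  trace_eq v (Gamma2 `|` Gamma3) (cst 0).

Definition sinh (t : R) : R := (expR t - expR (- t)) / 2.

(* The products with eps and with c are automatically integrable. *)
Definition weak_solution (Gamma2 Gamma3 : set 'cV[R]_n)
    (eps : dom Omega -> R) (delta : R) (g : H1) (c : L2 Omega) (u : H1) : Prop :=
  (exists2 w, H1_lin (-1) g u w & V0 Gamma2 Gamma3 w) /\
  forall v, V0 Gamma2 Gamma3 v ->
    (leb Omega).-integrable [set: dom Omega] (fun x => (sinh (u x) * v x)%:E) /\
    \int[leb Omega]_x (eps x * \sum_i grad u i x * grad v i x) +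
      2 * delta ^+ 2 * \int[leb Omega]_x (sinh (u x) * v x) =
      \int[leb Omega]_x (c x * v x).

End Sobolev.

Notation borel_L2 Omega := (g_sigma_algebraType (@L2_open _ _ Omega)).
Notation borel_cV R N := (g_sigma_algebraType (@open 'cV[R]_N)).

Section Bayes.
Context {R : realType} {N : nat}.

Definition gaussian_pdf (Sigma : 'M[R]_N) (x : 'cV[R]_N) : R :=
  (Num.sqrt ((2 * pi) ^+ N * \det Sigma))^-1 *
  expR (- (dotv x (invmx Sigma *m x)) / 2).

Definition is_gaussian (Sigma : 'M[R]_N) (nu : probability (borel_cV R N) R) :=
  forall B : set (borel_cV R N), measurable B ->
    nu B = (\int[leb [set: 'cV[R]_N]]_(x in B) (gaussian_pdf Sigma x)%:E)%E.

Context {d : measure_display} {X : measurableType d}.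
Variable mu0 : probability X R.

(* mu is a regular conditional distribution of c given y = G c + e, where     *)
(* (c, e) has law mu0 (x) noise.                                              *)
Definition is_posterior (G : X -> 'cV[R]_N)
    (noise : probability (borel_cV R N) R)
    (mu : 'cV[R]_N -> probability X R) : Prop :=
  forall A : set X, measurable A ->
    measurable_fun [set: borel_cV R N] (fun y => mu y A) /\
    forall B : set (borel_cV R N), measurable B ->
      ((mu0 \x noise) [set ce | A ce.1 /\ B (G ce.1 + ce.2)%R] =
       \int[mu0 \x noise]_(ce in [set ce | B (G ce.1 + ce.2)%R])
          mu (G ce.1 + ce.2)%R A)%E.

Definition RN_deriv (nu : probability X R) : X -> \bar R :=
  Radon_Nikodym (charge_of_finite_measure nu) mu0.

Definition hellinger (nu1 nu2 : probability X R) : R :=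
  Num.sqrt (2^-1 * \int[mu0]_x
    (Num.sqrt (fine (RN_deriv nu1 x)) -
     Num.sqrt (fine (RN_deriv nu2 x)))
    ^+ 2).

(* S stands for Sigma^{-1/2} *)
Definition misfit (S : 'M[R]_N) (G : X -> 'cV[R]_N) (c : X) (y : 'cV[R]_N) : R :=
  2^-1 * enorm (S *m (y - G c)) ^+ 2.

Definition evidence (S : 'M[R]_N) (G : X -> 'cV[R]_N) (y : 'cV[R]_N) : R :=
  \int[mu0]_c expR (- misfit S G c y).

End Bayes.

(* Main.v *)
From HB Require Import structures.
Require Import Defs.
From mathcomp Require Import all_boot all_order all_algebra.
From mathcomp Require Import all_classical all_reals all_analysis.
From mathcomp Require Import measurable_realfun ring lra.
Set Implicit Arguments.
Unset Strict Implicit.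
Unset Printing Implicit Defensive.
Import Order.TTheory GRing.Theory Num.Theory.
Import numFieldNormedType.Exports.
Local Open Scope classical_set_scope.
Local Open Scope ring_scope.

(* For a bounded domain every weak derivative is tested against bounded
   continuous functions, so differences of elements of H^1 lie in H^1, and
   boundedness and linearity of O turn the Lipschitz bound for W into one for
   G.  Since G is Borel measurable, Tonelli's theorem and the translation
   invariance of Lebesgue measure give the law of (c, G c + e) the density
   k exp (- J(c; y)) with respect to mu0 x Lebesgue, whence Bayes' formula.
   Stability rests on two facts requiring no moment of mu0: exp (- |z|^2 / 4)
   is globally Lipschitz in z, so that exp (- J(c; y) / 2) is Lipschitz in y
   uniformly in c, and |S (y - G c)|^2 <= 2 |S y|^2 + 2 |S G c|^2 bounds the
   normalisation z(y) away from 0 on bounded sets of data. *)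

(** * Measurability of halfspaces *)

Section BoxVolume.
Local Open Scope ereal_scope.
Context {R : realType} {n : nat}.
Implicit Types (A B H Omega : set 'cV[R]_n) (a b : 'cV[R]_n).

Lemma box_volume_set0 : box_volume (@set0 'cV[R]_n) = 0.
Proof. by rewrite /box_volume eqxx. Qed.

Lemma box_volume_ge0 A : 0 <= box_volume A.
Proof.
rewrite /box_volume; case: ifP => // _.
apply: le_ereal_inf_tmp => _ [[a b] /= [ab _] <-].
by rewrite lee_fin; apply: prodr_ge0 => i _; rewrite subr_ge0.
Qed.

Lemma box_volume_le A a b : (forall i, a i 0 <= b i 0)%R -> A `<=` box a b ->
  box_volume A <= (\prod_i (b i 0 - a i 0)%R)%:E.
Proof.
move=> ab Aab; rewrite /box_volume; case: ifP => _; last first.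
  by apply: ereal_inf_lbound; exists (a, b).
by rewrite lee_fin; apply: prodr_ge0 => i _; rewrite subr_ge0.
Qed.

Definition set_coord i (t : R) a : 'cV[R]_n :=
  (\col_j if j == i then t else a j 0)%R.

(** A hyperplane orthogonal to a coordinate axis cuts an enclosing box into two boxes, and each
    encloses the corresponding piece of [A]. If the hyperplane misses the box, one piece is empty
    and costs nothing. *)
Lemma box_volume_split i (t : R) A :
  box_volume (A `&` [set x | x i 0 <= t]%R) +
  box_volume (A `&` ~` [set x | x i 0 <= t]%R) <= box_volume A.
Proof.
have [->|A0] := eqVneq A set0; first by rewrite !set0I box_volume_set0 adde0.
rewrite {3}/box_volume (negbTE A0).
apply: le_ereal_inf_tmp => _ [[a b] /= [ab Aab] <-].
have [ta|at_] := ltP t (a i 0)%R.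
  rewrite (_ : A `&` _ = set0) ?box_volume_set0 ?add0e.
    by apply: box_volume_le => // x [] /Aab.
  apply/seteqP; split => // x [/Aab /(_ i) /andP[ax _] /= xt].
  by have := lt_le_trans ta (le_trans ax xt); rewrite ltxx.
have [bt|tb] := leP (b i 0)%R t.
  rewrite [X in _ + box_volume X](_ : _ = set0) ?box_volume_set0 ?adde0.
    by apply: box_volume_le => // x [] /Aab.
  apply/seteqP; split => // x [/Aab /(_ i) /andP[_ xb] /=]; apply.
  exact: le_trans xb bt.
(* Only the i-th side is cut: b_i - a_i = (t - a_i) + (b_i - t), and the other factors are
   common. *)
have -> : (\prod_j (b j 0 - a j 0))%R =
    ((\prod_j (set_coord i t b j 0 - a j 0)) +
     (\prod_j (b j 0 - set_coord i t a j 0)))%R.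
  rewrite (bigD1 i)//= [X in _ = (X + _)%R](bigD1 i)//=.
  rewrite [X in _ = (_ + X)%R](bigD1 i)//= !mxE eqxx.
  under [X in _ = (_ * X + _)%R]eq_bigr => j /negbTE ji do rewrite mxE ji.
  under [X in _ = (_ + _ * X)%R]eq_bigr => j /negbTE ji do rewrite mxE ji.
  by rewrite -mulrDl [in RHS]addrC addrA subrK.
rewrite EFinD; apply: leeD; apply: box_volume_le.
- by move=> j; rewrite mxE; case: eqP => [->|].
- move=> x [/Aab xab /= xt] j; rewrite mxE; case: eqP => [->|//].
  by rewrite xt andbT; have /andP[] := xab i.
- by move=> j; rewrite mxE; case: eqP => [->|//]; rewrite ltW.
- move=> x [/Aab xab /= /negP xt] j; rewrite mxE; case: eqP => [->|//].
  by rewrite -ltNge in xt; rewrite ltW//; have /andP[] := xab i.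
Qed.

(** Cutting each member of a cover of [A] by [H] yields covers of both pieces of [A], so the
    inequality passes from single sets to the outer measure. This is the nontrivial half of
    Caratheodory's criterion. *)
Lemma cover_outer_split (rho : set 'cV[R]_n -> \bar R) H :
  (forall A, 0 <= rho A) ->
  (forall A, rho (A `&` H) + rho (A `&` ~` H) <= rho A) ->
  forall A, cover_outer rho (A `&` H) + cover_outer rho (A `&` ~` H) <=
    cover_outer rho A.
Proof.
move=> rho0 rhoH A; apply: le_ereal_inf_tmp => _ [F AF <-].
apply: (@le_trans _ _ (\sum_(k <oo) (rho (F k `&` H) + rho (F k `&` ~` H)))).
  rewrite nneseriesD//; apply: leeD; apply: ereal_inf_lbound.
    exists (fun k => F k `&` H) => // x [/AF [k _ Fkx] Hx].
    by exists k.
  exists (fun k => F k `&` ~` H) => // x [/AF [k _ Fkx] Hx].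
  by exists k.
by apply: lee_nneseries => // k _ _; rewrite adde_ge0.
Qed.

Lemma measurable_halfspace Omega i (t : R) :
  measurable ([set x | x i 0 <= t]%R : set (dom Omega)).
Proof.
apply: le_caratheodory_measurable => X /=.
rewrite /lebesgue_outer ![_ `&` _ `&` Omega]setIAC.
apply: cover_outer_split; first exact: box_volume_ge0.
exact: box_volume_split.
Qed.

End BoxVolume.

(** * Lebesgue measurability of open sets, finite measure of bounded sets *)

Section OpenMeasurable.
Context {R : realType} {n : nat}.
Implicit Types (Omega U : set 'cV[R]_n).

(** Boxes are half open so that each is a finite intersection of sets x_i <= t and complements of
    such sets; rational corners keep the family countable. *)
Definition rat_box (pq : 'cV[rat]_n * 'cV[rat]_n) : set 'cV[R]_n :=
  [set x | forall i, ratr (pq.1 i 0) < x i 0 <= ratr (pq.2 i 0)].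

Lemma open_rat_box U : open U ->
  U = \bigcup_(pq in [set pq | rat_box pq `<=` U]) rat_box pq.
Proof.
move=> oU; apply/seteqP; split => [x Ux|x [pq /= pqU]]; last exact: pqU.
have /nbhs_ballP[e /= e0 xeU] := open_nbhs_nbhs (conj oU Ux).
have hp i : exists q : rat, ratr q \in `]x i 0 - e, x i 0[.
  by apply: rat_in_itvoo; rewrite ltrBlDr ltrDl.
have hq i : exists q : rat, ratr q \in `]x i 0, x i 0 + e[.
  by apply: rat_in_itvoo; rewrite ltrDl.
pose p : 'cV[rat]_n := \col_i projT1 (cid (hp i)).
pose q : 'cV[rat]_n := \col_i projT1 (cid (hq i)).
have pP i : x i 0 - e < ratr (p i 0) < x i 0.
  by rewrite mxE; case: cid => r /=; rewrite in_itv.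
have qP i : x i 0 < ratr (q i 0) < x i 0 + e.
  by rewrite mxE; case: cid => r /=; rewrite in_itv.
exists (p, q) => /=.
  move=> y /= py; apply: xeU; split => // i j; rewrite ord1.
  rewrite /ball /= ltr_distl.
  have /andP[p1 p2] := pP i; have /andP[q1 q2] := qP i; have /andP[y1 y2] := py i.
  by apply/andP; split; lra.
move=> i /=; have /andP[p1 p2] := pP i; have /andP[q1 q2] := qP i.
by rewrite p2 ltW.
Qed.

Lemma measurable_rat_box Omega pq : measurable (rat_box pq : set (dom Omega)).
Proof.
rewrite (_ : rat_box pq = \bigcap_(i in [set: 'I_n])
    ([set x : 'cV[R]_n | x i 0 <= ratr (pq.2 i 0)] `&`
     ~` [set x | x i 0 <= ratr (pq.1 i 0)])); last first.
  apply/seteqP; split => x /= h i.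
    by move=> _; have /andP[h1 h2] := h i; split => //=; apply/negP; rewrite -ltNge.
  by have [/= -> /negP] := h i I; rewrite -ltNge andbT.
apply: fin_bigcap_measurable => //= i _.
apply: measurableI; first exact: measurable_halfspace.
by apply: measurableC; exact: measurable_halfspace.
Qed.

Lemma open_measurable_dom Omega U : open U -> measurable (U : set (dom Omega)).
Proof.
move=> oU; rewrite (open_rat_box oU).
rewrite bigcup_mkcond; apply: countable_bigcupT_measurable => // pq.
by case: ifP => // _; exact: measurable_rat_box.
Qed.

Lemma continuous_measurable_dom Omega (f : 'cV[R]_n -> R) : continuous f ->
  measurable_fun [set: dom Omega] (f : dom Omega -> R).
Proof.
move=> cf; apply: (measurability _ (RGenOInfty.measurableE R)).
move=> _ [_ [a ->] <-]; rewrite setTI; apply: open_measurable_dom.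
by move/continuousP: cf; apply; exact: interval_open.
Qed.

Lemma cover_outer_box_bounded U : bounded_set U ->
  (cover_outer box_volume U < +oo)%E.
Proof.
move=> [M [_ /(_ (`|M| + 1))]].
rewrite (le_lt_trans (ler_norm _)) ?ltrDl// => /(_ isT) UM.
have M0 : 0 <= `|M| + 1 by rewrite addr_ge0.
apply: (@le_lt_trans _ _ (box_volume U)).
  apply: ereal_inf_lbound.
  (* The cover by [U] alone, padded with empty sets, costs [box_volume U]. *)
  exists (fun k : nat => if k == 0%N then U else set0).
    by move=> x Ux; exists 0%N.
  rewrite nneseries_recl//=; last by move=> k _; exact: box_volume_ge0.
  rewrite eseries0 ?adde0// => i i0 _.
  by rewrite gtn_eqF// box_volume_set0.
apply: (le_lt_trans (@box_volume_le _ _ _ (const_mx (- (`|M| + 1)))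
  (const_mx (`|M| + 1)) _ _)).
- by move=> i; rewrite !mxE; lra.
- move=> x /UM /= xM i; rewrite !mxE -ler_norml.
  apply: le_trans xM; rewrite /Num.norm/= mx_normrE.
  exact: (le_bigmax _ (fun ij => `|x ij.1 ij.2|) (i, 0)).
- by rewrite ltry.
Qed.

Lemma leb_bounded Omega : bounded_set Omega ->
  (leb Omega [set: dom Omega] < +oo)%E.
Proof.
by move=> bO; rewrite /leb/= /lebesgue_outer setTI cover_outer_box_bounded.
Qed.

End OpenMeasurable.

(** * Lebesgue measure on Borel sets and its translation invariance *)

Section BorelLebesgue.
Local Open Scope ereal_scope.
Context {R : realType} {n : nat}.
Implicit Types (A : set 'cV[R]_n) (a : 'cV[R]_n).

Lemma measurable_id_borel Omega :
  measurable_fun [set: dom Omega] (fun x : dom Omega => x : borel_cV R n).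
Proof.
apply: (@measurability _ _ _ (borel_cV R n) _ _ (@open 'cV[R]_n)) => //.
by move=> _ [U oU <-]; rewrite setTI; exact: open_measurable_dom.
Qed.

(** The image of Lebesgue measure under the identity. It moves integrals from the Caratheodory
    sigma-algebra, used in [is_gaussian], to the Borel sigma-algebra carrying [noise], where
    Tonelli's theorem is applied. *)
Definition borel_leb : set (borel_cV R n) -> \bar R :=
  pushforward (leb [set: 'cV[R]_n])
    (fun x : dom [set: 'cV[R]_n] => x : borel_cV R n).

Let borel_leb0 : borel_leb set0 = 0.
Proof. by rewrite /borel_leb /pushforward preimage_set0 measure0. Qed.

Let borel_leb_ge0 A : 0 <= borel_leb A.
Proof. exact: (measure_ge0 (leb [set: 'cV[R]_n])). Qed.

Let borel_leb_sigma_additive : semi_sigma_additive borel_leb.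
Proof.
move=> F mF tF mUF.
have mB B : measurable (B : set (borel_cV R n)) ->
    measurable (B : set (dom [set: 'cV[R]_n])).
  by move=> mB; rewrite -[X in measurable X]setTI; exact: measurable_id_borel.
have mF' i : measurable (F i : set (dom [set: 'cV[R]_n])) by exact: mB.
exact: (measure_semi_sigma_additive _ mF' tF (mB _ mUF)).
Qed.

HB.instance Definition _ := isMeasure.Build _ _ _ borel_leb
  borel_leb0 borel_leb_ge0 borel_leb_sigma_additive.

Let borel_leb_sigma_finite : sigma_finite setT borel_leb.
Proof.
exists (fun k => [set x : 'cV[R]_n | `|x| < k%:R]%R).
  apply/esym/seteqP; split => // x _; exists (Num.truncn `|x|).+1 => //=.
  by rewrite truncnS_gt.
move=> k; split.
  rewrite (_ : mkset _ = (ball 0 k%:R : set (borel_cV R n)))%R.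
    apply: sub_sigma_algebra
 => /=; exact: ball_open.
  by apply/seteqP; split => x; rewrite -ball_normE /ball_/= sub0r normrN.
rewrite /borel_leb /pushforward/= /leb/= /lebesgue_outer setIT.
apply: cover_outer_box_bounded; exists k%:R; split; first exact: realn.
by move=> M kM x /= xk; rewrite ltW// (lt_trans xk).
Qed.

HB.instance Definition _ := @Measure_isSigmaFinite.Build _ _ _ borel_leb
  borel_leb_sigma_finite.

Lemma box_volume_translate a A :
  box_volume [set x | A (x + a)%R] <= box_volume A.
Proof.
have [->|A0] := eqVneq A set0.
  by rewrite (_ : mkset _ = set0) ?box_volume_set0.
rewrite [leRHS]/box_volume (negbTE A0).
apply: le_ereal_inf_tmp => _ [[p q] /= [pq Apq] <-].
rewrite (_ : (\prod_i _)%R =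
    (\prod_i ((q - a) i 0 - (p - a) i 0))%R); last first.
  by apply: eq_bigr => i _; rewrite !mxE; ring.
apply: box_volume_le => [i|x /Apq xpq i]; first by rewrite !mxE lerD2r.
by have := xpq i; rewrite !mxE lerBlDr lerBrDr.
Qed.

(** Translating a cover gives one inequality for every set and every vector; the translation by - a,
    which undoes the first one, gives the converse. Measurability of [A] does not enter because the
    values are those of an outer measure. *)
Lemma borel_leb_translate a A : borel_leb [set x | A (x + a)%R] = borel_leb A.
Proof.
have le b B : borel_leb [set x | B (x + b)%R] <= borel_leb B.
  rewrite /borel_leb /pushforward/= /leb/= /lebesgue_outer !setIT.
  apply: le_ereal_inf_tmp => _ [F BF <-].
  apply: (@le_trans _ _ (\sum_(k <oo) box_volume [set x | F k (x + b)%R])).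
    apply: ereal_inf_lbound; exists (fun k => [set x | F k (x + b)%R]) => //.
    by move=> x /BF [k _ Fk]; exists k.
  by apply: lee_nneseries => // k _ *; rewrite ?box_volume_ge0 ?box_volume_translate.
apply/eqP; rewrite eq_le le /=.
apply: le_trans (le (- a)%R [set x | A (x + a)%R]).
by under [X in _ <= borel_leb X]eq_set do rewrite /= addrNK.
Qed.

Lemma measurable_translate_borel a :
  measurable_fun [set: borel_cV R n]
    (fun x : borel_cV R n => (x + a)%R : borel_cV R n).
Proof.
apply: (@measurability _ _ _ (borel_cV R n) _ _ (@open 'cV[R]_n)) => //.
move=> _ [U oU <-]; rewrite setTI; apply: sub_sigma_algebra => /=.
have ca : continuous (fun x : 'cV[R]_n => x + a)%R.
  by move=> x; apply: (@continuousD _ _ _ id (cst a)); [exact: cvg_id|exact: cst_continuous].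
by apply: (@open_comp 'cV[R]_n 'cV[R]_n (fun x => x + a)%R) => // x _; exact: ca.
Qed.

(** By invariance, the image of the measure under the translation is the measure itself. *)
Lemma ge0_integral_translate a (f : 'cV[R]_n -> \bar R) :
  measurable_fun [set: borel_cV R n] (f : borel_cV R n -> \bar R) ->
  (forall x, 0 <= f x) ->
  \int[borel_leb]_x f (x + a)%R = \int[borel_leb]_x f x.
Proof.
move=> mf f0.
transitivity (\int[pushforward borel_leb
    (fun x : borel_cV R n => (x + a)%R : borel_cV R n)]_x f x).
  by rewrite (ge0_integral_pushforward (measurable_translate_borel a))// preimage_setT.
apply: eq_measure_integral => [|mt A mA _]; last exact: borel_leb_translate.
exact: measurable_translate_borel.
Qed.

Lemma ge0_integral_borel_leb (B : set (borel_cV R n)) (f : 'cV[R]_n -> \bar R) :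
  measurable B -> measurable_fun B (f : borel_cV R n -> \bar R) ->
  (forall x, 0 <= f x) ->
  \int[leb [set: 'cV[R]_n]]_(x in B) f x = \int[borel_leb]_(x in B) f x.
Proof.
move=> mB mf f0.
have := ge0_integral_pushforward (measurable_id_borel (Omega := [set: 'cV[R]_n]))
  (leb [set: 'cV[R]_n]) mB mf (fun x _ => f0 x).
exact: esym.
Qed.

End BorelLebesgue.

(** * Measures given by a density *)

Section Density.
Local Open Scope ereal_scope.
Context d (T : measurableType d) (R : realType).
Variables (mu : {sigma_finite_measure set T -> \bar R})
  (nu : {finite_measure set T -> \bar R}) (p : T -> \bar R).
Hypotheses (p_ge0 : forall x, 0 <= p x) (mp : measurable_fun [set: T] p).
Hypothesis nuE : forall A, measurable A -> nu A = \int[mu]_(x in A) p x.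

Lemma density_dominates : nu `<< mu.
Proof.
apply/null_content_dominatesP => A mA muA0; rewrite nuE//.
by apply: null_set_integral => //; exact: measurable_funTS.
Qed.

Lemma density_integrable : mu.-integrable [set: T] p.
Proof.
apply/integrableP; split => //; under eq_integral do rewrite gee0_abs//.
by rewrite -nuE// -ge0_fin_numE// fin_num_measure.
Qed.

(** Both functions are integrable and have the same integral, namely [nu A], over every measurable
    set [A]. *)
Lemma density_Radon_Nikodym :
  ae_eq mu setT p (Radon_Nikodym (charge_of_finite_measure nu) mu).
Proof.
apply: integral_ae_eq => //; first exact: density_integrable.
  apply: measurable_int; apply: Radon_Nikodym_integrable.
  exact: density_dominates.
by move=> A _ mA; rewrite -nuE// -Radon_Nikodym_integral//; exact: density_dominates.
Qed.

(** The change of variables holds with the Radon-Nikodym derivative as the weight, and that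
    derivative equals [p] almost everywhere by uniqueness. *)
Lemma ge0_integral_density (f : T -> \bar R) : measurable_fun [set: T] f ->
  (forall x, 0 <= f x) -> \int[nu]_x f x = \int[mu]_x (f x * p x).
Proof.
move=> mf f0; have numu := density_dominates.
rewrite -(Radon_Nikodym_SigmaFinite.change_of_variables numu)//.
have mRN : measurable_fun [set: T] (Radon_Nikodym_SigmaFinite.f nu mu).
  exact: measurable_int (Radon_Nikodym_SigmaFinite.f_integrable numu).
apply: ae_eq_integral => //; [exact: emeasurable_funM..|].
apply: ae_eqe_mul2l; apply: integral_ae_eq => //.
  exact: Radon_Nikodym_SigmaFinite.f_integrable.
by move=> A _ mA; rewrite -Radon_Nikodym_SigmaFinite.f_integral// nuE.
Qed.

End Density.

(** * Almost everywhere equality and bounded functions *)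

Lemma ae_eq_Lnorm d (T : measurableType d) (R : realType)
    (mu : {measure set T -> \bar R}) (p : R) (f g : T -> R) :
  measurable_fun [set: T] f -> measurable_fun [set: T] g ->
  {ae mu, forall x, f x = g x} ->
  ('N[mu]_p%:E[EFin \o f] = 'N[mu]_p%:E[EFin \o g])%E.
Proof.
move=> mf mg fg.
have mp (h : T -> R) : measurable_fun [set: T] h ->
    measurable_fun [set: T] (fun x => (`|h x| `^ p)%:E).
  move=> mh; apply/measurable_EFinP.
  apply: (@measurableT_comp _ _ _ _ _ _ (@powR R ^~ p)) => //.
  exact: measurableT_comp.
have E : (\int[mu]_x (`|f x| `^ p)%:E = \int[mu]_x (`|g x| `^ p)%:E)%E.
  apply: ae_eq_integral => //; [exact: mp..|].
  by apply: filterS fg => x /= -> _.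
by rewrite Lnorm.unlock /Lnorm.body /= E.
Qed.

Lemma ae_eq_Rintegral d (T : measurableType d) (R : realType)
    (mu : {measure set T -> \bar R}) (f g : T -> R) :
  measurable_fun [set: T] f -> measurable_fun [set: T] g ->
  {ae mu, forall x, f x = g x} -> \int[mu]_x f x = \int[mu]_x g x.
Proof.
move=> mf mg fg; rewrite /Rintegral; congr fine; apply: ae_eq_integral => //.
- exact/measurable_EFinP.
- exact/measurable_EFinP.
- by apply: filterS fg => x -> _.
Qed.

Lemma bounded_Lfun d (T : measurableType d) (R : realType)
    (mu : {measure set T -> \bar R}) (f : T -> R) (M r : R) : 1 <= r ->
  (mu [set: T] < +oo)%E -> measurable_fun [set: T] f ->
  (forall x, `|f x| <= M) -> f \in Lfun mu r%:E.
Proof.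
move=> r1 muT mf fM; rewrite inE; apply/andP; split; rewrite inE//=.
rewrite /finite_norm unlock; apply: poweR_lty.
apply: (@le_lt_trans _ _ (\int[mu]_x (M `^ r)%:E)%E); last first.
  by rewrite integral_cst// lte_mul_pinfty// lee_fin powR_ge0.
apply: ge0_le_integral => //=.
- apply/measurable_EFinP.
  apply: (@measurableT_comp _ _ _ _ _ _ (@powR R ^~ r)) => //.
  exact: measurableT_comp.
- move=> x _; rewrite lee_fin ge0_ler_powR// ?(le_trans _ r1)// nnegrE//.
  exact: le_trans (fM x).
Qed.

Lemma compact_support_bounded (R : realType) (V : normedModType R)
    (f : V -> R) (K : set V) :
  compact K -> continuous f -> (forall x, ~ K x -> f x = 0) ->
  exists M, forall x, `|f x| <= M.
Proof.
move=> cK cf f0.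
have /compact_bounded[M [_ /(_ (`|M| + 1))]] : compact (f @` K).
  by apply: continuous_compact => //; exact: continuous_subspaceT.
rewrite (le_lt_trans (ler_norm _)) ?ltrDl// => /(_ isT) fM.
exists (`|M| + 1) => x; have [Kx|/f0 ->] := pselect (K x).
  by apply: fM; exists x.
by rewrite normr0 addr_ge0.
Qed.

(** * Differences in L^2 *)

Section L2functions.
Context {R : realType} {n : nat}.
Variable Omega : set 'cV[R]_n.
Implicit Types u v w : L2 Omega.

Lemma measurable_L2 u : measurable_fun [set: dom Omega] (u : dom Omega -> R).
Proof.
have H := @measurable_funPT _ _ _ _ (repr ((u : LspaceType _ _) :
  {mfun_ (leb Omega), (dom Omega) >-> (measurableTypeR R)})).
exact H.
Qed.

Lemma L2_Lfun u : (u : dom Omega -> R) \in Lfun (leb Omega) 2%:E.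
Proof.
rewrite inE; apply/andP; split; rewrite inE/=; first exact: measurable_L2.
by have := @Lebesgue_finite _ _ _ _ _ _ u.
Qed.

(** An element of [L2] is a class evaluated through a chosen representative, so the element built
    from [f] agrees with [f] only almost everywhere. *)
Lemma exists_L2 (f : dom Omega -> R) : f \in Lfun (leb Omega) 2%:E ->
  exists u, {ae leb Omega, forall x, u x = f x}.
Proof.
move=> /andP[]; rewrite inE/= => mf; rewrite inE/= => Nf.
pose fm : {mfun (dom Omega) >-> (measurableTypeR R)} :=
  HB.pack_for {mfun (dom Omega) >-> (measurableTypeR R)} f
   (isMeasurableFun.Build _ _ (dom Omega) (measurableTypeR R) f mf).
pose q : {mfun_ (leb Omega), (dom Omega) >-> (measurableTypeR R)} :=
  (\pi_({mfun_ (leb Omega), (dom Omega) >-> (measurableTypeR R)}) fm)%qT.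
have qf : {ae leb Omega, forall x, q x = f x}.
  have /eqmodP/asboolP z0 : (repr q = fm
      %[mod {mfun_ (leb Omega), (dom Omega) >-> (measurableTypeR R)}])%qT.
    by rewrite reprK.
  by apply: filterS z0 => x /(_ I).
have Nq : finite_norm (leb Omega) 2%:E q.
  have mq : measurable_fun [set: dom Omega] (q : dom Omega -> R).
    have H := @measurable_funPT _ _ _ _ (repr q).
    exact H.
  by rewrite /finite_norm (ae_eq_Lnorm 2 mq mf qf).
pose u : LspaceType (leb Omega) (lee1n 2) :=
  HB.pack_for (LspaceType (leb Omega) (lee1n 2)) q
    (@isFinLebesgue.Build _ _ _ (leb Omega) 2%:E (lee1n 2) q Nq).
by exists u.
Qed.

Lemma L2_subr u v : exists w, {ae leb Omega, forall x, w x = u x - v x}.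
Proof.
apply: (@exists_L2 (fun x => u x - v x)).
have [_ /(_ (-1) _ _ (L2_Lfun v) (L2_Lfun u))] :=
  Lfun_submod_closed (leb Omega) (lee1n 2 : (1 <= 2%:E)%E).
move=> uv; rewrite (_ : (fun x => _) = -1 *: L2_fun v + L2_fun u)//.
by apply/funext => x; rewrite !fctE scaleN1r addrC.
Qed.

Lemma L2dist_ae u v w : {ae leb Omega, forall x, w x = u x - v x} ->
  L2norm w = L2dist u v.
Proof.
move=> wuv.
have muv := measurable_funB (measurable_L2 u) (measurable_L2 v).
by rewrite /L2dist /L2norm (ae_eq_Lnorm 2 (measurable_L2 w) muv wuv).
Qed.

End L2functions.

(** * Differences in H^1 and the Lipschitz bound for the observation operator *)

Section H1difference.
Context {R : realType} {n : nat}.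
Variables (Omega : set 'cV[R]_n).
Hypothesis bOmega : bounded_set Omega.
Implicit Types u v w : H1 Omega.

Lemma test_function_bounded (phi : 'cV[R]_n -> R) : test_function Omega phi ->
  continuous phi /\ exists M, forall x, `|phi x| <= M.
Proof.
move=> [sphi [K [cK _ phi0]]]; have cphi : continuous phi by have [] := sphi 0%N.
by split => //; exact: compact_support_bounded cK _ _.
Qed.

(** The support [K] is closed, so outside it [phi] vanishes on a neighbourhood and its derivative
    vanishes too. The derivative is thus continuous and zero off a compact set. *)
Lemma pderiv_test_function_bounded (phi : 'cV[R]_n -> R) i :
  test_function Omega phi ->
  continuous (pderiv i phi) /\ exists M, forall x, `|pderiv i phi x| <= M.
Proof.
move=> [sphi [K [cK _ phi0]]].
have cphi : continuous (pderiv i phi).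
  by have [_ /(_ i) [_ []]] := sphi 1%N.
split => //; apply: (compact_support_bounded cK) => // x Kx.
have oK : open (~` K).
  by apply: closed_openC; apply: compact_closed => //; exact: norm_hausdorff.
rewrite /pderiv (@near_eq_derive _ _ _ _ (cst 0)) ?derive_cst//.
have : nbhs x (~` K) by exact: open_nbhs_nbhs.
by apply: filterS => y /phi0.
Qed.

(** On a set of finite measure a bounded function is square integrable, and a product of two square
    integrable functions is integrable. *)
Lemma L2_mul_bounded_integrable (u : L2 Omega) (phi : 'cV[R]_n -> R) :
  continuous phi -> (exists M, forall x, `|phi x| <= M) ->
  (leb Omega).-integrable [set: dom Omega] (fun x => (u x * phi x)%:E).
Proof.
move=> cphi [M phiM]; apply/Lfun1_integrable; apply: Lfun2_mul_Lfun1.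
  exact: L2_Lfun.
have mphi := @continuous_measurable_dom _ _ Omega _ cphi.
by apply: (bounded_Lfun _ (leb_bounded bOmega) mphi phiM); rewrite ler1n.
Qed.

Lemma Rintegral_subr_ae (u v w : L2 Omega) (phi : 'cV[R]_n -> R) :
  continuous phi -> (exists M, forall x, `|phi x| <= M) ->
  {ae leb Omega, forall x, w x = u x - v x} ->
  \int[leb Omega]_x (w x * phi x) =
  \int[leb Omega]_x (u x * phi x) - \int[leb Omega]_x (v x * phi x).
Proof.
move=> cphi bphi wuv.
have mphi : measurable_fun [set: dom Omega] phi by exact: continuous_measurable_dom.
have mM (h : L2 Omega) := measurable_funM (measurable_L2 h) mphi.
have iM (h : L2 Omega) := L2_mul_bounded_integrable h cphi bphi.
rewrite -(RintegralB measurableT (iM u) (iM v)).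
apply: (ae_eq_Rintegral (mM w) (measurable_funB (mM u) (mM v))).
by apply: filterS wuv => x /= ->; rewrite mulrBl.
Qed.

(** The identity defining weak derivatives is linear once its products are integrable, so the
    differences of the partial derivatives are those of the difference. The norm equality links
    [H1dist] to an actual element, to which a linear operator can be applied. *)
Lemma H1_subr u v : exists w, H1_lin (-1) v u w /\ H1norm w = H1dist u v.
Proof.
have [w wuv] := L2_subr u v.
have hg i : exists g : L2 Omega, {ae leb Omega, forall x, g x = grad u i x - grad v i x}.
  exact: L2_subr.
pose g i := projT1 (cid (hg i)).
have gP i : {ae leb Omega, forall x, g i x = grad u i x - grad v i x}.
  by rewrite /g; case: cid.
have gw i phi : test_function Omega phi ->
    \int[leb Omega]_x (w x * pderiv i phi x) =
      - \int[leb Omega]_x (g i x * phi x).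
  move=> tphi; have [cp bp] := test_function_bounded tphi.
  have [cdp bdp] := pderiv_test_function_bounded i tphi.
  rewrite (Rintegral_subr_ae cdp bdp wuv) (Rintegral_subr_ae cp bp (gP i)).
  by rewrite !grad_weak// opprB opprK addrC.
exists (MkH1 gw); split.
  by apply: filterS wuv => x /= ->; rewrite mulN1r addrC.
rewrite /H1norm /H1dist/= (L2dist_ae wuv); congr (Num.sqrt (_ + _)).
by apply: eq_bigr => i _; rewrite (L2dist_ae (gP i)).
Qed.

Lemma bounded_linear_H1_lipschitz N (O : H1 Omega -> 'cV[R]_N) :
  bounded_linear_H1 O ->
  exists M, 0 <= M /\ forall u v, enorm (O u - O v) <= M * H1dist u v.
Proof.
(* The bound [M] may have any sign; its absolute value is a constant by which the estimate for [W]
   can later be multiplied. *)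
move=> [Olin [M OM]]; exists `|M|; split=> // u v.
have [w [wuv <-]] := H1_subr u v.
have -> : O u - O v = O w by rewrite (Olin _ _ _ _ wuv) scaleN1r addrC.
by rewrite (le_trans (OM w))// ler_wpM2r ?ler_norm// sqrtr_ge0.
Qed.

End H1difference.

(** * Borel measurability of vector-valued maps *)

Section BorelVectors.
Context {R : realType} {N : nat}.

Lemma continuous_measurable_borel (f : 'cV[R]_N -> R) : continuous f ->
  measurable_fun [set: borel_cV R N] (f : borel_cV R N -> R).
Proof.
move=> cf; apply: (measurability _ (RGenOInfty.measurableE R)).
move=> _ [_ [a ->] <-]; rewrite setTI; apply: sub_sigma_algebra => /=.
by move/continuousP: cf; apply; exact: interval_open.
Qed.

Lemma measurable_coord i :
  measurable_fun [set: borel_cV R N] (fun x : borel_cV R N => x i 0 : R).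
Proof. by apply: continuous_measurable_borel; exact: coord_continuous. Qed.

(** An open set is a countable union of rational boxes, and the preimage of a box is a finite
    intersection of conditions on single coordinates. *)
Lemma measurable_coords d (T : measurableType d) (f : T -> 'cV[R]_N) :
  (forall i, measurable_fun [set: T] (fun x => f x i 0)) ->
  measurable_fun [set: T] (f : T -> borel_cV R N).
Proof.
move=> mf; apply: (@measurability _ _ _ (borel_cV R N) _ _ (@open 'cV[R]_N)) => //.
move=> _ [U oU <-]; rewrite setTI (open_rat_box oU) preimage_bigcup.
rewrite bigcup_mkcond; apply: countable_bigcupT_measurable => // pq.
case: ifP => // _.
rewrite (_ : _ @^-1` _ = \bigcap_(i in [set: 'I_N]) ((fun x => f x i 0) @^-1`
    `]ratr (pq.1 i 0), ratr (pq.2 i 0)])); last first.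
  by apply/seteqP; split => x /= h i; [move=> _|];
    have := h i; rewrite /= in_itv/=; [|apply].
apply: fin_bigcap_measurable => //= i _; rewrite -[X in measurable X]setTI.
by apply: mf => //; exact: measurable_itv.
Qed.

End BorelVectors.

(** * Euclidean norm and quadratic forms *)

Section EuclideanAlgebra.
Context {R : realType} {N : nat}.
Implicit Types (x y : 'cV[R]_N) (M : 'M[R]_N).

Lemma dotvE x y : dotv x y = (x^T *m y) 0 0.
Proof. by rewrite mxE; apply: eq_bigr => i _; rewrite mxE. Qed.

Lemma enorm_sqr x : enorm x ^+ 2 = \sum_i x i 0 ^+ 2.
Proof. by rewrite sqr_sqrtr// sumr_ge0// => i _; exact: sqr_ge0. Qed.

Lemma enorm_ge0 x : 0 <= enorm x.
Proof. exact: sqrtr_ge0. Qed.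

Lemma normr_coord_le x i : `|x i 0| <= enorm x.
Proof.
rewrite -(ler_sqr (normr_ge0 _) (enorm_ge0 _)) ?nnegrE ?enorm_ge0//.
rewrite enorm_sqr real_normK ?num_real// (bigD1 i)//= lerDl.
by rewrite sumr_ge0// => j _; exact: sqr_ge0.
Qed.

Lemma dotv_symmetric_sqr M x : M^T = M -> dotv x (M *m M *m x) = enorm (M *m x) ^+ 2.
Proof.
move=> MT; rewrite dotvE enorm_sqr -mulmxA mulmxA -{1}MT -trmx_mul -dotvE.
by apply: eq_bigr => i _; rewrite expr2.
Qed.

End EuclideanAlgebra.

(** * Probability measures built from a density *)

Section DensityProbability.
Context d (T : measurableType d) (R : realType).

Lemma exists_density_probability (mu : {measure set T -> \bar R}) (p : T -> R) :
  measurable_fun [set: T] p -> (forall x, 0 <= p x) ->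
  (\int[mu]_x (p x)%:E = 1)%E ->
  exists nu : probability T R, forall A, nu A = (\int[mu]_(x in A) (p x)%:E)%E.
Proof.
move=> mp p0 p1.
pose nu (A : set T) := (\int[mu]_(x in A) (p x)%:E)%E.
have nu0 : nu set0 = 0%E by rewrite /nu integral_set0.
have nu_ge0 A : (0 <= nu A)%E by apply: integral_ge0 => x _; rewrite lee_fin.
have nu_sigma : semi_sigma_additive nu.
  move=> F mF tF mUF.
  rewrite /nu ge0_integral_bigcup//.
  - apply: is_cvg_ereal_nneg_natsum_cond => n _ _; exact: nu_ge0.
  - exact/measurable_EFinP/measurable_funTS.
  - by move=> x _; rewrite lee_fin.
pose numeasure := isMeasure.Build _ _ _ nu nu0 nu_ge0 nu_sigma.
pose m : {measure set T -> \bar R} :=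
  HB.pack_for {measure set T -> \bar R} nu numeasure.
pose P : probability T R := HB.pack_for (probability T R) nu numeasure
  (Measure_isProbability.Build _ _ _ m p1).
by exists P.
Qed.

End DensityProbability.

(** * The likelihood and its normalisation *)

Section Likelihood.
Context d (X : measurableType d) (R : realType) (N : nat).
Variables (mu0 : probability X R) (G : X -> 'cV[R]_N) (S : 'M[R]_N).
Hypothesis mG : measurable_fun [set: X] (G : X -> borel_cV R N).

Lemma misfit_ge0 c y : 0 <= misfit S G c y.
Proof. by rewrite mulr_ge0 ?invr_ge0 ?sqr_ge0. Qed.

Lemma likelihood_le1 c y : expR (- misfit S G c y) <= 1.
Proof. by rewrite -expR0 ler_expR oppr_le0 misfit_ge0. Qed.

(** In coordinates the misfit is a polynomial in the entries of y and G c. Joint measurability is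
    what Tonelli's theorem requires. *)
Lemma measurable_likelihood : measurable_fun [set: X * borel_cV R N]
  (fun cy : X * borel_cV R N => expR (- misfit S G cy.1 cy.2)).
Proof.
apply: measurableT_comp => //; apply: measurableT_comp => //.
under eq_fun do rewrite /misfit enorm_sqr.
apply: measurable_funM => //; apply: measurable_sum => i.
apply: measurable_funX; under eq_fun do rewrite mxE.
apply: measurable_sum => j; apply: measurable_funM => //.
under eq_fun do rewrite !mxE.
apply: measurable_funB.
  exact: (measurableT_comp (measurable_coord j) measurable_snd).
apply: (measurableT_comp (measurable_coord j)).
exact: (measurableT_comp mG measurable_fst).
Qed.

Lemma measurable_likelihoodl y :
  measurable_fun [set: X] (fun c => expR (- misfit S G c y)).
Proof. exact: (measurable_fun_pair1 (y : borel_cV R N) measurable_likelihood). Qed.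

Lemma likelihood_integrable y :
  mu0.-integrable [set: X] (fun c => (expR (- misfit S G c y))%:E).
Proof.
apply: (@le_integrable _ _ _ _ _ measurableT _ (cst 1%E)).
- by apply/measurable_EFinP; exact: measurable_likelihoodl.
- by move=> c _; rewrite /= lee_fin ger0_norm ?expR_ge0// normr1 likelihood_le1.
- exact: finite_measure_integrable_cst.
Qed.

Lemma EFin_evidence y :
  (evidence mu0 S G y)%:E = (\int[mu0]_c (expR (- misfit S G c y))%:E)%E.
Proof. by rewrite fineK//; exact: integrable_fin_num (likelihood_integrable y). Qed.

(** A nonnegative function of zero integral vanishes almost everywhere. The likelihood vanishes
    nowhere, so [X] would be a null set, against its mass 1. *)
Lemma evidence_gt0 y : 0 < evidence mu0 S G y.
Proof.
rewrite -lte_fin EFin_evidence lt_neqAle integral_ge0 ?andbT; last first.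
  by move=> c _; rewrite lee_fin expR_ge0.
apply/negP => /eqP/esym h.
have : (\int[mu0]_c `|(expR (- misfit S G c y))%:E| = 0)%E.
  by under eq_integral do rewrite /= ger0_norm ?expR_ge0//.
move/(ae_eq_integral_abs mu0 measurableT); case.
  by apply/measurable_EFinP; exact: measurable_likelihoodl.
move=> B [mB B0 sB].
have : mu0 setT = 0%E.
  apply/eqP; rewrite eq_le measure_ge0 andbT -B0 le_measure ?inE// => x _.
  apply: sB => /= /(_ I) [] /eqP; apply/negP; rewrite gt_eqF//; exact: expR_gt0.
by rewrite probability_setT => /eqP; rewrite onee_eq0.
Qed.

Lemma measurable_evidence :
  measurable_fun [set: borel_cV R N] (evidence mu0 S G : borel_cV R N -> R).
Proof.
apply/measurable_EFinP; rewrite /comp.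
under eq_fun do rewrite EFin_evidence.
apply: (@measurable_fun_fubini_tonelli_G _ _ X (borel_cV R N) R mu0
  (fun cy => (expR (- misfit S G cy.1 cy.2))%:E)) => //=.
by apply/measurable_EFinP; exact: measurable_likelihood.
Qed.

Lemma measurable_evidence_inv : measurable_fun [set: borel_cV R N]
  ((fun y => (evidence mu0 S G y)^-1) : borel_cV R N -> R).
Proof.
(* On positive numbers the inverse is the power of exponent -1, a measurable function. *)
under eq_fun do rewrite -powR_inv1 ?ltW ?evidence_gt0//.
exact: (measurableT_comp (measurable_powR _) measurable_evidence).
Qed.

End Likelihood.

(** * Bayes' formula *)

Section BayesFormula.
Context d (X : measurableType d) (R : realType) (N : nat).
Variables (mu0 : probability X R) (G : X -> 'cV[R]_N) (Sigma S : 'M[R]_N).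
Hypothesis mG : measurable_fun [set: X] (G : X -> borel_cV R N).
Hypothesis hS : inv_sqrtmx Sigma S.
Variable noise : probability (borel_cV R N) R.
Hypothesis hnoise : is_gaussian Sigma noise.

(** The constant k in the joint density k exp (- J(c; y)). *)
Definition gaussian_peak : R := (Num.sqrt ((2 * pi) ^+ N * \det Sigma))^-1.

Lemma gaussian_peak_ge0 : 0 <= gaussian_peak.
Proof. by rewrite invr_ge0 sqrtr_ge0. Qed.

(** [S] is symmetric with square [invmx Sigma], so the quadratic form is |S (y - H c)|^2. The space
    [T] is arbitrary so that a one-point space with H = 0 recovers the Gaussian density and its
    measurability. *)
Lemma gaussian_pdfE d' (T : measurableType d') (H : T -> 'cV[R]_N) c y :
  gaussian_pdf Sigma (y - H c) = gaussian_peak * expR (- misfit S H c y).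
Proof.
rewrite /gaussian_pdf; case: hS => -[ST _] <-.
rewrite dotv_symmetric_sqr// /misfit; congr (_ * expR _).
by rewrite mulNr mulrC.
Qed.

Lemma measurable_gaussian_pdf :
  measurable_fun [set: borel_cV R N] (gaussian_pdf Sigma : borel_cV R N -> R).
Proof.
have E y : gaussian_pdf Sigma y =
    gaussian_peak * expR (- misfit S (fun=> 0) tt y).
  by rewrite -(@gaussian_pdfE _ unit (fun=> 0)) subr0.
rewrite (funext E); apply: measurable_funM => //.
have m0 : measurable_fun [set: unit] ((fun=> 0) : unit -> borel_cV R N).
  exact: measurable_cst.
exact: (measurable_fun_pair2 tt (measurable_likelihood S m0)).
Qed.

Lemma gaussian_pdf_ge0 y : 0 <= gaussian_pdf Sigma y.
Proof. by rewrite mulr_ge0 ?expR_ge0 ?gaussian_peak_ge0. Qed.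

Lemma noise_density B : measurable B ->
  noise B = (\int[borel_leb]_(x in B) (gaussian_pdf Sigma x)%:E)%E.
Proof.
move=> mB; rewrite hnoise// ge0_integral_borel_leb//.
  apply/measurable_funTS/measurable_EFinP; exact: measurable_gaussian_pdf.
by move=> x; rewrite lee_fin gaussian_pdf_ge0.
Qed.

Lemma measurable_unknown_data : measurable_fun [set: X * borel_cV R N]
  (fun ce : X * borel_cV R N => (ce.1, G ce.1 + ce.2 : borel_cV R N)).
Proof.
apply: measurable_fun_pair => //.
apply: measurable_coords => i; under eq_fun do rewrite mxE.
apply: measurable_funD.
  apply: (measurableT_comp (measurable_coord i)).
  exact: (measurableT_comp mG measurable_fst).
exact: (measurableT_comp (measurable_coord i) measurable_snd).
Qed.

(* Shifting e by G c turns the law of (c, G c + e) into a density with respect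
   to mu0 x Lebesgue. *)
Lemma joint_law_density (f : X * borel_cV R N -> \bar R) :
  measurable_fun [set: X * borel_cV R N] f -> (forall cy, 0 <= f cy)%E ->
  (\int[mu0 \x noise]_ce f (ce.1, (G ce.1 + ce.2)%R) =
   \int[borel_leb]_y \int[mu0]_c
     (f (c, y) * (gaussian_peak * expR (- misfit S G c y))%:E))%E.
Proof.
move=> mf f0.
have mpdf : measurable_fun [set: borel_cV R N]
    (fun y : borel_cV R N => (gaussian_pdf Sigma y)%:E).
  apply/measurable_EFinP; exact: measurable_gaussian_pdf.
have mfshift : measurable_fun [set: X * borel_cV R N]
    (fun ce : X * borel_cV R N => f (ce.1, G ce.1 + ce.2)).
  exact: (measurableT_comp mf measurable_unknown_data).
have slice c : (\int[noise]_e f (c, (G c + e)%R) = \int[borel_leb]_y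
    (f (c, y) * (gaussian_peak * expR (- misfit S G c y))%:E))%E.
  pose g (y : borel_cV R N) : \bar R :=
    (f (c, y) * (gaussian_peak * expR (- misfit S G c y))%:E)%E.
  have mg : measurable_fun [set: borel_cV R N] g.
    apply: emeasurable_funM; first exact: (measurable_fun_pair2 c mf).
    apply/measurable_EFinP; apply: measurable_funM => //.
    exact: (measurable_fun_pair2 c (measurable_likelihood S mG)).
  have g0 y : (0 <= g y)%E.
    by rewrite mule_ge0// lee_fin mulr_ge0 ?gaussian_peak_ge0 ?expR_ge0.
  have mfc := measurable_fun_pair2 c mfshift.
  have -> : (\int[noise]_e f (c, (G c + e)%R) =
      \int[borel_leb]_e (f (c, (G c + e)%R) * (gaussian_pdf Sigma e)%:E))%E.
    exact: (ge0_integral_density mpdf noise_density mfc (fun e => f0 _)).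
  rewrite -[RHS](ge0_integral_translate (G c) mg g0).
  by apply: eq_integral => e _; rewrite /g addrC -gaussian_pdfE addrK.
have -> : (\int[mu0 \x noise]_ce f (ce.1, (G ce.1 + ce.2)%R) =
    \int[mu0]_c \int[noise]_e f (c, (G c + e)%R))%E.
  exact: (fubini_tonelli1 _ mfshift (fun ce => f0 _)).
rewrite (eq_integral _ _ (fun c _ => slice c)).
apply: (@fubini_tonelli _ _ X (borel_cV R N) R mu0 borel_leb
  (fun cy => f cy * (gaussian_peak * expR (- misfit S G cy.1 cy.2))%:E)%E).
- apply: emeasurable_funM => //.
  apply/measurable_EFinP; apply: measurable_funM => //.
  exact: (measurable_likelihood S mG).
- move=> cy; rewrite mule_ge0// lee_fin.
  by rewrite mulr_ge0 ?gaussian_peak_ge0 ?expR_ge0.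
Qed.

Lemma integral_bayes_numerator A y : measurable A ->
  (\int[mu0]_(c in A) ((evidence mu0 S G y)^-1 * expR (- misfit S G c y))%:E =
   ((evidence mu0 S G y)^-1)%:E * \int[mu0]_(c in A) (expR (- misfit S G c y))%:E)%E.
Proof.
move=> mA; under eq_integral do rewrite EFinM.
rewrite ge0_integralZl//.
- apply/measurable_EFinP/measurable_funTS; exact: measurable_likelihoodl.
- by rewrite lee_fin invr_ge0 ltW// evidence_gt0.
Qed.

Lemma exists_bayes_measure : exists mu : 'cV[R]_N -> probability X R,
  forall y A, mu y A = (\int[mu0]_(c in A)
    ((evidence mu0 S G y)^-1 * expR (- misfit S G c y))%:E)%E.
Proof.
have /choice[mu muE] : forall y, exists nu : probability X R, forall A,
    nu A = (\int[mu0]_(c in A)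
      ((evidence mu0 S G y)^-1 * expR (- misfit S G c y))%:E)%E.
  move=> y; apply: exists_density_probability.
  - apply: measurable_funM => //; exact: measurable_likelihoodl.
  - by move=> c; rewrite mulr_ge0 ?expR_ge0// invr_ge0 ltW// evidence_gt0.
  - rewrite integral_bayes_numerator// -EFin_evidence// -EFinM mulVf//.
    by rewrite gt_eqF// evidence_gt0.
by exists mu.
Qed.

(** Both sides of the defining identity are integrals against the law of (c, G c + e). Written with
    its density, they have equal inner integrals for each y, because z(y) times [mu y A] is the
    integral of exp (- J) over [A]. *)
Lemma bayes_measure_is_posterior (mu : 'cV[R]_N -> probability X R) :
  (forall y A, mu y A = (\int[mu0]_(c in A)
    ((evidence mu0 S G y)^-1 * expR (- misfit S G c y))%:E)%E) ->
  is_posterior mu0 G noise mu.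
Proof.
move=> muE A mA.
have mmu : measurable_fun [set: borel_cV R N] (fun y => mu y A).
  under eq_fun do rewrite muE integral_mkcond epatch_indic.
  apply: (@measurable_fun_fubini_tonelli_G _ _ X (borel_cV R N) R mu0
    (fun cy => ((evidence mu0 S G cy.2)^-1 * expR (- misfit S G cy.1 cy.2))%:E *
      (\1_A cy.1)%:E)%E).
    apply: emeasurable_funM; apply/measurable_EFinP.
      apply: measurable_funM; last exact: measurable_likelihood.
      exact: (measurableT_comp (measurable_evidence_inv mu0 S mG) measurable_snd).
    exact: (measurableT_comp (measurable_indic mA) measurable_fst).
  move=> cy; rewrite mule_ge0// lee_fin// mulr_ge0 ?expR_ge0// invr_ge0 ltW//.
  exact: evidence_gt0.
split => // B mB.
pose h (ce : X * borel_cV R N) : X * borel_cV R N := (ce.1, G ce.1 + ce.2).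
have mh : measurable_fun setT h by exact: measurable_unknown_data.
have mAB : measurable (A `*` B) by exact: measurableX.
rewrite (_ : [set ce | A ce.1 /\ _] = h @^-1` (A `*` B))//.
transitivity (\int[mu0 \x noise]_ce (\1_(A `*` B) (h ce))%:E)%E.
  rewrite (_ : (fun ce => _) = (fun ce => (\1_(h @^-1` (A `*` B)) ce)%:E))//.
  rewrite integral_indic ?setIT//.
  by rewrite -[X in measurable X]setTI; exact: mh.
rewrite (@joint_law_density (fun cy => (\1_(A `*` B) cy)%:E)); last 2 first.
- by apply/measurable_EFinP; exact: measurable_indic.
- by move=> cy; rewrite lee_fin.
rewrite [RHS]integral_mkcond epatch_indic.
rewrite (@joint_law_density (fun cy => mu cy.2 A * (\1_B cy.2)%:E)%E); last 2 first.
- apply: emeasurable_funM; first exact: (measurableT_comp mmu measurable_snd).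
  apply/measurable_EFinP; exact: (measurableT_comp (measurable_indic mB) measurable_snd).
- by move=> cy; rewrite mule_ge0// lee_fin.
apply: eq_integral => y _ /=.
have mq D : measurable_fun D (fun c => (expR (- misfit S G c y))%:E).
  apply/measurable_funTS/measurable_EFinP; exact: measurable_likelihoodl.
have q0 c : (0 <= (expR (- misfit S G c y))%:E)%E by rewrite lee_fin expR_ge0.
have Z0 : evidence mu0 S G y != 0 by rewrite gt_eqF// evidence_gt0.
(* This is the common value of the two inner integrals at y. *)
transitivity ((gaussian_peak * \1_B y)%:E *
    \int[mu0]_(c in A) (expR (- misfit S G c y))%:E)%E.
  rewrite -ge0_integralZl//; last by rewrite lee_fin mulr_ge0// gaussian_peak_ge0.
  rewrite [RHS]integral_mkcond epatch_indic.
  apply: eq_integral => c _; rewrite -!EFinM; congr (_%:E).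
  rewrite !indicE in_setX/= -mulnb natrM; ring.
(* On the right [mu y A] is constant in c, so integrating the likelihood produces the evidence,
   which cancels the normalisation of [mu y A]. *)
under [RHS]eq_integral do rewrite EFinM muleA.
rewrite ge0_integralZl//; last first.
  by rewrite !mule_ge0// lee_fin// gaussian_peak_ge0.
rewrite -(EFin_evidence _ _ mG) muE integral_bayes_numerator//.
set I := (\int[mu0]_(c in A) _)%E.
rewrite muleC -[RHS]muleA -[RHS]muleA [RHS]muleAC [RHS]muleC -!EFinM.
congr (_ * _%:E)%E; field => //.
Qed.

End BayesFormula.

(** * Lipschitz bounds for Gaussian factors and their products *)

Section LipschitzExp.
Context {R : realType}.

(** For b - a >= 1 the difference is at most 1. Otherwise 1 - exp (- x) <= x bounds it by exp (- a^2
    / 4) (b - a) (a + b) / 4, and (a + b) / 4 <= exp (a^2 / 4). *)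
Lemma expR_quarter_sqr_lipschitz_le (a b : R) : 0 <= a -> a <= b ->
  expR (- (a ^+ 2 / 4)) - expR (- (b ^+ 2 / 4)) <= b - a.
Proof.
move=> a0 ab.
have [ba1|ba1] := leP 1 (b - a).
  apply: le_trans ba1; rewrite lerBlDr (le_trans (y := 1))//.
    by rewrite -[leRHS]expR0 ler_expR oppr_le0 divr_ge0// sqr_ge0.
  by rewrite lerDl expR_ge0.
have -> : expR (- (b ^+ 2 / 4)) =
    expR (- (a ^+ 2 / 4)) * expR (- ((b ^+ 2 - a ^+ 2) / 4)).
  by rewrite -expRD; congr expR; field.
rewrite -[X in X - _]mulr1 -mulrBr.
have h1 : 1 - expR (- ((b ^+ 2 - a ^+ 2) / 4)) <= (b - a) * ((b + a) / 4).
  rewrite lerBlDr -lerBlDl (le_trans _ (expR_ge1Dx _))//.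
  by rewrite le_eqVlt; apply/orP; left; apply/eqP; field.
apply: (le_trans (ler_wpM2l (expR_ge0 _) h1)).
rewrite mulrCA -[leRHS]mulr1 ler_wpM2l ?subr_ge0// expRN.
rewrite ler_pdivrMl ?expR_gt0// mulr1 (le_trans _ (expR_ge1Dx _))//.
(* As b < a + 1, (a + b) / 4 is below (2 a + 1) / 4, which is at most 1 + a^2 / 4 because 2 a <= a^2
   + 1. *)
have := sqr_ge0 (a - 1); nra.
Qed.

Lemma expR_quarter_sqr_lipschitz (s t : R) :
  `|expR (- (s ^+ 2 / 4)) - expR (- (t ^+ 2 / 4))| <= `|s - t|.
Proof.
wlog st : s t / `|s| <= `|t|.
  by move=> H; have [/H//|/ltW/H] := leP `|s| `|t|; rewrite distrC (distrC s).
have le0 := expR_quarter_sqr_lipschitz_le (normr_ge0 s) st.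
rewrite !real_normK ?num_real// in le0.
rewrite ger0_norm; last first.
  rewrite subr_ge0 ler_expR lerN2 ler_pM2r//.
  by rewrite -(real_normK (num_real s)) -(real_normK (num_real t)) ler_sqr ?nnegrE.
by apply: (le_trans le0); rewrite distrC; exact: lerB_dist.
Qed.

(** The factors are exchanged one at a time, and the remaining ones have absolute value at most
    1. *)
Lemma prod_unit_lipschitz (I : Type) (r : seq I) (a b : I -> R) :
  (forall i, 0 <= a i <= 1) -> (forall i, 0 <= b i <= 1) ->
  `|\prod_(i <- r) a i - \prod_(i <- r) b i| <= \sum_(i <- r) `|a i - b i|.
Proof.
move=> a01 b01; elim: r => [|i r IH]; first by rewrite !big_nil subrr normr0.
rewrite !big_cons.
set A := \prod_(j <- r) a j in IH *; set B := \prod_(j <- r) b j in IH *.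
have A01 : 0 <= A <= 1.
  by rewrite prodr_ge0/= ?prodr_ile1// => j _; have /andP[] := a01 j.
have -> : a i * A - b i * B = (a i - b i) * A + b i * (A - B) by ring.
apply: (le_trans (ler_normD _ _)); rewrite !normrM lerD//.
  by have /andP[A0 A1] := A01; rewrite (ger0_norm A0) ler_piMr.
have /andP[b0 b1] := b01 i; rewrite (ger0_norm b0).
by apply: le_trans IH; rewrite ler_piMl.
Qed.

End LipschitzExp.

(** * Dependence of the likelihood and the evidence on the data *)

Section Stability.
Context d (X : measurableType d) (R : realType) (N : nat).
Variables (mu0 : probability X R) (G : X -> 'cV[R]_N) (S : 'M[R]_N).
Hypothesis mG : measurable_fun [set: X] (G : X -> borel_cV R N).

Definition sqrt_likelihood c y : R := expR (- (misfit S G c y / 2)).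

Lemma sqrt_likelihood_sqr c y :
  sqrt_likelihood c y ^+ 2 = expR (- misfit S G c y).
Proof. by rewrite expr2 -expRD; congr expR; field. Qed.

Lemma sqrt_likelihood01 c y : 0 <= sqrt_likelihood c y <= 1.
Proof.
rewrite expR_ge0/= -[leRHS]expR0 ler_expR oppr_le0.
by rewrite divr_ge0// misfit_ge0.
Qed.

(** Times |x|, it bounds the sum over i of |(S x)_i|, the shape in which [prod_unit_lipschitz]
    delivers its estimate. *)
Definition mx_sum_norm : R := \sum_i \sum_j `|S i j|.

Lemma mx_sum_norm_ge0 : 0 <= mx_sum_norm.
Proof. by apply: sumr_ge0 => i _; apply: sumr_ge0. Qed.

Lemma normr_mulmx_le (x : 'cV[R]_N) i :
  `|(S *m x) i 0| <= (\sum_j `|S i j|) * enorm x.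
Proof.
rewrite mxE (le_trans (ler_norm_sum _ _ _))// mulr_suml ler_sum// => j _.
by rewrite normrM ler_wpM2l// normr_coord_le.
Qed.

(** The root of the likelihood is the product of exp (- t_i^2 / 4) over the coordinates t_i of S (y
    - G c), each factor being 1-Lipschitz in t_i. Between two data t_i changes by (S (y1 - y2))_i,
    in which G c cancels; hence the uniformity in c. *)
Lemma sqrt_likelihood_lipschitz c y1 y2 :
  `|sqrt_likelihood c y1 - sqrt_likelihood c y2| <= mx_sum_norm * enorm (y1 - y2).
Proof.
have E y : sqrt_likelihood c y =
    \prod_i expR (- ((S *m (y - G c)) i 0 ^+ 2 / 4)).
  rewrite -expR_sum /sqrt_likelihood /misfit enorm_sqr; congr expR.
  rewrite sumrN -mulr_suml; congr (- _); by field.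
have e01 (t : R) : 0 <= expR (- (t ^+ 2 / 4)) <= 1.
  by rewrite expR_ge0/= -[leRHS]expR0 ler_expR oppr_le0 divr_ge0// sqr_ge0.
rewrite !E (le_trans (prod_unit_lipschitz _ (fun=> e01 _) (fun=> e01 _)))//.
rewrite mulr_suml ler_sum// => i _.
apply: (le_trans (expR_quarter_sqr_lipschitz _ _)).
have := normr_mulmx_le (y1 - y2) i; apply: le_trans.
rewrite le_eqVlt; apply/orP; left; apply/eqP; congr `|_|.
have -> : y1 - y2 = (y1 - G c) - (y2 - G c) by rewrite opprB addrA subrK.
by rewrite [in RHS]mulmxBr [in RHS]mxE [X in _ = _ + X]mxE.
Qed.

(** The likelihood is the square of its root, and a^2 - b^2 = (a - b) (a + b) with a + b <= 2,
    whence the factor 2. *)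
Lemma evidence_lipschitz y1 y2 :
  `|evidence mu0 S G y1 - evidence mu0 S G y2| <=
    2 * mx_sum_norm * enorm (y1 - y2).
Proof.
have le z1 z2 : evidence mu0 S G z1 - evidence mu0 S G z2 <=
    2 * mx_sum_norm * enorm (z1 - z2).
  set K := 2 * _ * _.
  have -> : K = \int[mu0]_c (cst K c).
    rewrite Rintegral_cst// [X in fine X](_ : _ = 1%E) ?mulr1//.
    exact: probability_setT.
  have i1 := likelihood_integrable mu0 S mG z1.
  have i2 := likelihood_integrable mu0 S mG z2.
  apply: (le_trans (y := \int[mu0]_c
      (expR (- misfit S G c z1) - expR (- misfit S G c z2)))).
    by rewrite (RintegralB measurableT i1 i2).
  apply: le_Rintegral => //.
  - exact: (integrableB measurableT i1 i2).
  - exact: finite_measure_integrable_cst.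
  move=> c _ /=; rewrite -!sqrt_likelihood_sqr subr_sqr.
  have := sqrt_likelihood_lipschitz c z1 z2; rewrite ler_norml => /andP[_ h].
  have /andP[u0 u1] := sqrt_likelihood01 c z1.
  have /andP[v0 v1] := sqrt_likelihood01 c z2.
  have D0 := mulr_ge0 mx_sum_norm_ge0 (enorm_ge0 (z1 - z2)).
  rewrite /K -mulrA; set D := _ * _ in h D0 *; nra.
rewrite ler_norml le andbT lerNl opprB (le_trans (le _ _))//.
rewrite le_eqVlt; apply/orP; left; apply/eqP; congr (_ * _).
by rewrite -(opprB y1 y2) /enorm; congr Num.sqrt; apply: eq_bigr => i _;
  rewrite mxE sqrrN.
Qed.

(* The factor 2 comes from (a - b)^2 <= 2 a^2 + 2 b^2. *)
Lemma evidence_lower_bound r y : enorm y <= r ->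
  expR (- (\sum_i ((\sum_j `|S i j|) * r) ^+ 2)) *
    evidence mu0 (2 *: S) G 0 <= evidence mu0 S G y.
Proof.
move=> yr; have i0 := likelihood_integrable mu0 (2 *: S) mG 0.
set k := expR _.
apply: (le_trans (y := \int[mu0]_c (k * expR (- misfit (2 *: S) G c 0)))).
  by rewrite (RintegralZl _ measurableT i0).
apply: le_Rintegral => //.
- exact: (integrableZl measurableT _ i0).
- exact: likelihood_integrable.
move=> c _; rewrite /= -expRD ler_expR /misfit !enorm_sqr.
rewrite -opprD lerN2 !mulr_sumr -big_split/= ler_sum// => i _.
have := normr_mulmx_le y i => /le_trans/(_ (ler_wpM2l (sumr_ge0 _ _) yr)) h.
have {}h : (S *m y) i 0 ^+ 2 <= ((\sum_j `|S i j|) * r) ^+ 2.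
  rewrite -real_normK ?num_real// ler_sqr ?nnegrE//; first exact: h.
  exact: le_trans (normr_ge0 _) (h _).
rewrite mulmxBr sub0r mulmxN -scalemxAl !mxE.
set a := (\sum_j S i j * y j 0); set b := \sum_j S i j * G c j 0.
rewrite mxE -/a in h.
(* From (a + b)^2 >= 0 follows (a - b)^2 / 2 <= a^2 + b^2; the first term is covered by [h], the
   second by (2 b)^2 / 2. *)
have := sqr_ge0 (a + b); nra.
Qed.

End Stability.

(** The product of |sqrt z1 - sqrt z2| and sqrt z1 + sqrt z2 is |z1 - z2| <= 2 E, and the sum is at
    least 2 sqrt m, so the roots differ by at most E / sqrt m. Passing to reciprocals costs two more
    factors 1 / sqrt m, which explains the cube. *)
Lemma sqrt_density_lipschitz (R : realType) (m E h1 h2 z1 z2 : R) :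
  0 < m -> m <= z1 -> m <= z2 -> 0 <= h2 <= 1 -> `|h1 - h2| <= E ->
  `|z1 - z2| <= 2 * E ->
  `|(Num.sqrt z1)^-1 * h1 - (Num.sqrt z2)^-1 * h2| <=
    ((Num.sqrt m)^-1 + (Num.sqrt m)^-1 ^+ 3) * E.
Proof.
move=> m0 mz1 mz2 /andP[h20 h21] hE zE.
have z10 := lt_le_trans m0 mz1; have z20 := lt_le_trans m0 mz2.
set s := Num.sqrt m; set s1 := Num.sqrt z1; set s2 := Num.sqrt z2.
have s0 : 0 < s by rewrite sqrtr_gt0.
have s10 : 0 < s1 by rewrite sqrtr_gt0.
have s20 : 0 < s2 by rewrite sqrtr_gt0.
have ss1 : s1^-1 <= s^-1 by rewrite lef_pV2 ?posrE// ler_wsqrtr.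
have ss2 : s2^-1 <= s^-1 by rewrite lef_pV2 ?posrE// ler_wsqrtr.
have sd : `|s2 - s1| <= E * s^-1.
  rewrite ler_pdivlMr// -(@ler_pM2l _ 2)//.
  apply: le_trans zE; rewrite -(sqr_sqrtr (ltW z10)) -(sqr_sqrtr (ltW z20)) -/s1 -/s2.
  rewrite subr_sqr normrM (distrC s1) mulrCA ler_wpM2l//.
  rewrite ger0_norm ?addr_ge0 ?(ltW s10) ?(ltW s20)// mulr2n mulrDl mul1r.
  by rewrite lerD// ler_wsqrtr.
have -> : s1^-1 * h1 - s2^-1 * h2 =
    s1^-1 * (h1 - h2) + h2 * ((s2 - s1) * (s1^-1 * s2^-1)).
  by field; rewrite !gt_eqF.
rewrite [leRHS]mulrDl (le_trans (ler_normD _ _))// lerD//.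
  by rewrite normrM gtr0_norm ?invr_gt0// ler_pM ?invr_ge0 ?(ltW s10).
rewrite normrM (ger0_norm h20) (le_trans (ler_piMl _ h21))// normrM.
rewrite [`|s1^-1 * _|]gtr0_norm ?mulr_gt0 ?invr_gt0//.
rewrite (_ : s^-1 ^+ 3 * E = E * s^-1 * (s^-1 * s^-1)); last by ring.
by rewrite ler_pM// ?mulr_ge0 ?ler_pM ?invr_ge0 ?(ltW s10) ?(ltW s20).
Qed.

Lemma Rintegral_le_cst d (X : measurableType d) (R : realType)
    (P : probability X R) (f : X -> R) (M : R) : measurable_fun [set: X] f ->
  (forall x, 0 <= f x <= M) -> \int[P]_x f x <= M.
Proof.
move=> mf f0M.
have -> : M = \int[P]_x (cst M x).
  rewrite Rintegral_cst// [X in fine X](_ : _ = 1%E) ?mulr1//.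
  exact: probability_setT.
have iM := finite_measure_integrable_cst P M measurableT.
apply: le_Rintegral => // [|x _]; last by have /andP[] := f0M x.
apply: le_integrable iM => //; first exact/measurable_EFinP.
move=> x _; have /andP[f0 fM] := f0M x.
by rewrite /= lee_fin !ger0_norm// (le_trans f0).
Qed.

(** * Hellinger stability *)

Section Hellinger.
Context d (X : measurableType d) (R : realType) (N : nat).
Variables (mu0 : probability X R) (G : X -> 'cV[R]_N) (S : 'M[R]_N).
Hypothesis mG : measurable_fun [set: X] (G : X -> borel_cV R N).
Variable mu : 'cV[R]_N -> probability X R.
Hypothesis muE : forall y A, mu y A = (\int[mu0]_(c in A)
  ((evidence mu0 S G y)^-1 * expR (- misfit S G c y))%:E)%E.

Let density y c := (evidence mu0 S G y)^-1 * expR (- misfit S G c y).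

Lemma measurable_bayes_density y : measurable_fun [set: X] (density y).
Proof. by apply: measurable_funM => //; exact: measurable_likelihoodl. Qed.

Lemma bayes_density_ge0 y c : 0 <= density y c.
Proof. by rewrite mulr_ge0 ?expR_ge0// invr_ge0 ltW// evidence_gt0. Qed.

Lemma bayes_measure_dominates y : mu y `<< mu0.
Proof.
apply: (@density_dominates _ _ _ mu0 (mu y) (fun c => (density y c)%:E)).
  by apply/measurable_EFinP; exact: measurable_bayes_density.
by move=> A mA; exact: muE.
Qed.

Lemma bayes_RN_deriv y :
  {ae mu0, forall c, RN_deriv mu0 (mu y) c = (density y c)%:E}.
Proof.
have := @density_Radon_Nikodym _ _ _ mu0 (mu y) (fun c => (density y c)%:E).
move=> H; apply: filterS (H _ _ _) => [c /(_ I) -> //|c||A mA].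
- by rewrite lee_fin bayes_density_ge0.
- by apply/measurable_EFinP; exact: measurable_bayes_density.
- exact: muE.
Qed.

Lemma sqrt_density y c : Num.sqrt (density y c) =
  (Num.sqrt (evidence mu0 S G y))^-1 * sqrt_likelihood G S c y.
Proof.
rewrite /density sqrtrM ?invr_ge0 ?(ltW (evidence_gt0 _ _ mG _))//.
rewrite sqrtrV ?(ltW (evidence_gt0 _ _ mG _))// -sqrt_likelihood_sqr sqrtr_sqr.
by rewrite ger0_norm// expR_ge0.
Qed.

Let measurable_sqrt : measurable_fun [set: R] (@Num.sqrt R).
Proof. by apply: continuous_measurable_fun; exact: sqrt_continuous. Qed.

Let measurable_sqr_sqrt_density y1 y2 : measurable_fun [set: X]
  (fun c => (Num.sqrt (density y1 c) - Num.sqrt (density y2 c)) ^+ 2).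
Proof.
apply: measurable_funX; apply: measurable_funB;
  apply: (measurableT_comp measurable_sqrt); exact: measurable_bayes_density.
Qed.

Let measurable_RN_deriv y : measurable_fun [set: X] (RN_deriv mu0 (mu y)).
Proof.
apply: (measurable_int mu0); apply: Radon_Nikodym_integrable.
exact: bayes_measure_dominates.
Qed.

(** The Radon-Nikodym derivatives are the explicit densities only almost everywhere, which suffices
    under the integral. *)
Lemma hellingerE y1 y2 : hellinger mu0 (mu y1) (mu y2) = Num.sqrt (2^-1 *
  \int[mu0]_c (Num.sqrt (density y1 c) - Num.sqrt (density y2 c)) ^+ 2).
Proof.
rewrite /hellinger; congr (Num.sqrt (_ * _)); apply: ae_eq_Rintegral.
- apply: measurable_funX; apply: measurable_funB;
    apply: (measurableT_comp measurable_sqrt);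
    exact: measurableT_comp (measurable_RN_deriv _).
- exact: measurable_sqr_sqrt_density.
- by apply: filterS2 (bayes_RN_deriv y1) (bayes_RN_deriv y2) => c /= -> ->.
Qed.

(** The roots of the two densities differ by at most K |y1 - y2| uniformly in c, and integration
    against a probability measure keeps the bound. K depends on the data only through [r]. *)
Lemma hellinger_lipschitz r : 0 < r -> exists2 C : R, 0 < C &
  forall y1 y2, Num.max (enorm y1) (enorm y2) < r ->
    hellinger mu0 (mu y1) (mu y2) <= C * enorm (y1 - y2).
Proof.
move=> r0.
(* The second factor is the integral of exp (- 2 |S G c|^2), an evidence for the matrix [2 *: S] at
   data 0 and therefore positive. *)
pose m := expR (- (\sum_i ((\sum_j `|S i j|) * r) ^+ 2)) *
  evidence mu0 (2 *: S) G 0.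
have m0 : 0 < m by rewrite mulr_gt0 ?expR_gt0 ?evidence_gt0.
pose K := ((Num.sqrt m)^-1 + (Num.sqrt m)^-1 ^+ 3) * mx_sum_norm S.
have K0 : 0 <= K.
  by rewrite mulr_ge0 ?mx_sum_norm_ge0// addr_ge0 ?exprn_ge0// invr_ge0 sqrtr_ge0.
(* [K] may be 0, while the constant has to be positive. *)
exists (K + 1) => [|y1 y2]; first by rewrite ltr_wpDl.
rewrite gt_max => /andP[y1r y2r].
have mZ1 := evidence_lower_bound mu0 S mG (ltW y1r).
have mZ2 := evidence_lower_bound mu0 S mG (ltW y2r).
have D0 := enorm_ge0 (y1 - y2).
rewrite hellingerE (le_trans (y := K * enorm (y1 - y2)))//; last first.
  by rewrite ler_wpM2r// lerDl.
have KD0 := mulr_ge0 K0 D0.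
rewrite -[leRHS](ger0_norm KD0) -sqrtr_sqr ler_wsqrtr//.
have Kle c : `|Num.sqrt (density y1 c) - Num.sqrt (density y2 c)| <=
    K * enorm (y1 - y2).
  have -> : Num.sqrt (density y1 c) - Num.sqrt (density y2 c) =
      (Num.sqrt (evidence mu0 S G y1))^-1 * sqrt_likelihood G S c y1 -
      (Num.sqrt (evidence mu0 S G y2))^-1 * sqrt_likelihood G S c y2.
    by congr (_ - _); exact: sqrt_density.
  have h01 := sqrt_likelihood01 G S c y2.
  have hL := sqrt_likelihood_lipschitz G S c y1 y2.
  have := evidence_lipschitz mu0 S mG y1 y2.
  by rewrite /K -!mulrA => /(sqrt_density_lipschitz m0 mZ1 mZ2 h01 hL).
apply: (@le_trans _ _ (\int[mu0]_c
    (Num.sqrt (density y1 c) - Num.sqrt (density y2 c)) ^+ 2)).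
  rewrite ler_piMl ?invf_le1 ?ler1n//.
  by apply: Rintegral_ge0 => c _; exact: sqr_ge0.
apply: Rintegral_le_cst => [|c].
  exact: measurable_sqr_sqrt_density.
rewrite sqr_ge0/= -real_normK ?num_real// ler_sqr ?nnegrE//.
Qed.

End Hellinger.

(** * Measurability of the forward operator and the conclusion *)

(** Preimages of open sets are open for [L2dist], hence generators of the Borel sigma-algebra.
    Openness of vectors refers to the sup norm, which the Euclidean norm dominates. *)
Lemma lipschitz_measurable_L2 (R : realType) (n N : nat) (Omega : set 'cV[R]_n)
    (G : L2 Omega -> 'cV[R]_N) (L : R) :
  (forall u v, enorm (G u - G v) <= L * L2dist u v) ->
  measurable_fun [set: borel_L2 Omega] (G : borel_L2 Omega -> borel_cV R N).
Proof.
move=> GL; apply: (@measurability _ _ _ (borel_cV R N) _ _ (@open 'cV[R]_N)) => //.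
move=> _ [U oU <-]; rewrite setTI; apply: sub_sigma_algebra => u /= UGu.
have /nbhs_ballP[e /= e0 eU] := open_nbhs_nbhs (conj oU UGu).
have L0 : 0 < `|L| + 1 by rewrite ltr_wpDl.
(* [L] may be zero or negative; [|L| + 1] is a positive Lipschitz constant. *)
exists (e / (`|L| + 1)) => [|v uv]; first by rewrite divr_gt0.
apply: eU; split => // i j; rewrite ord1 /ball/=.
have := normr_coord_le (G u - G v) i; rewrite !mxE => /le_lt_trans; apply.
apply: (le_lt_trans (GL u v)).
have d0 : 0 <= L2dist u v by exact: fine_ge0 (Lnorm_ge0 _ _ _).
apply: (@le_lt_trans _ _ ((`|L| + 1) * L2dist u v)).
  by rewrite ler_wpM2r// (le_trans (ler_norm _))// lerDl.
by rewrite mulrC -ltr_pdivlMr.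
Qed.

Theorem theorem3 (R : realType) (d : nat) (hd : (0 < d <= 3)%N)
    (Omega : set 'cV[R]_d) (hOmega : lipschitz_domain Omega)
    (Gamma1 Gamma2 Gamma3 : set 'cV[R]_d)
    (hGamma : boundary Omega = Gamma1 `|` Gamma2 `|` Gamma3)
    (delta : R) (hdelta : 0 < delta)
    (eps : dom Omega -> R) (eps_meas : measurable_fun [set: dom Omega] eps)
    (eps0 eps1 : R) (heps0 : 0 < eps0)
    (heps : {ae leb Omega, forall x, eps0 <= eps x <= eps1})
    (f1 f2 : 'cV[R]_d -> R) (g : H1 Omega)
    (hg1 : trace_eq g Gamma2 f1) (hg2 : trace_eq g Gamma3 f2)
    (W : L2 Omega -> H1 Omega)
    (hW : forall c, weak_solution Gamma2 Gamma3 eps delta g c (W c))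
    (eta : R) (hWlip : forall c1 c2, H1dist (W c1) (W c2) <= eta * L2dist c1 c2)
    (N : nat) (O : H1 Omega -> 'cV[R]_N) (hO : bounded_linear_H1 O)
    (mu0 : probability (borel_L2 Omega) R)
    (Sigma S : 'M[R]_N) (hSigma : posdefmx Sigma) (hS : inv_sqrtmx Sigma S)
    (noise : probability (borel_cV R N) R) (hnoise : is_gaussian Sigma noise) :
  let G := fun c : borel_L2 Omega => O (W c) in
  (exists L : R, forall c1 c2, enorm (G c1 - G c2) <= L * L2dist c1 c2) /\
  exists mu : 'cV[R]_N -> probability (borel_L2 Omega) R,
  [/\ is_posterior mu0 G noise mu,
      forall y,
        [/\ mu0.-integrable [set: borel_L2 Omega]
              (fun c => (expR (- misfit S G c y))%:E),
            0 < evidence mu0 S G y,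
            mu y `<< mu0 &
            {ae mu0, forall c,
              RN_deriv mu0 (mu y) c =
              ((evidence mu0 S G y)^-1 * expR (- misfit S G c y))%:E}] &
      forall r : R, 0 < r -> exists2 C : R, 0 < C &
        forall y1 y2, Num.max (enorm y1) (enorm y2) < r ->
          hellinger mu0 (mu y1) (mu y2) <= C * enorm (y1 - y2)].
Proof.
have bOmega : bounded_set Omega by case: hOmega.
have [M [M0 OL]] := bounded_linear_H1_lipschitz bOmega hO.
have GL c1 c2 : enorm (O (W c1) - O (W c2)) <= (M * eta) * L2dist c1 c2.
  by rewrite (le_trans (OL _ _))// -mulrA ler_wpM2l.
move=> G; split; first by exists (M * eta).
have mG : measurable_fun [set: borel_L2 Omega] (G : borel_L2 Omega -> borel_cV R N).
  exact: lipschitz_measurable_L2 GL.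
have [mu muE] := exists_bayes_measure mu0 S mG.
exists mu; split.
- exact: (bayes_measure_is_posterior mG hS hnoise muE).
- move=> y; split.
  + exact: likelihood_integrable.
  + exact: evidence_gt0.
  + exact: bayes_measure_dominates muE y.
  + exact: (bayes_RN_deriv mG muE y).
- exact: (hellinger_lipschitz mG muE).
Qed.
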